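(* Let $M$ be a loopless matroid of rank $d+1$ on $E$. Then $(A^\bullet(M),\int_M,\mathscr K_M)$ satisfies $\operatorname{HL}^{\le1}_{\mathscr K_M}$ and $\operatorname{HR}^{\le1}_{\mathscr K_M}$: for every $\ell\in\mathscr K_M$ and $i\in\{0,1\}$ with $i\le\lfloor d/2\rfloor$, multiplication by $\ell^{d-2i}:A^i(M)\to A^{d-i}(M)$ is an isomorphism, and the form $(-1)^i\int_M xy\ell^{d-2i}$ is positive definite on $P^i_\ell=\{z\in A^i(M): \ell^{d-2i+1}z=0\}$.
   Context: $A^\bullet(M)=\mathbb R[x_F: F\text{ nonempty proper flat}]/(\langle x_Fx_{F'}: F,F'\text{ incomparable}\rangle+\langle\sum_{F\ni i}x_F-\sum_{F\ni j}x_F: i,j\in E\rangle)$ with degree map $\int_M:A^d(M)\to\mathbb R$, $\int_Mx_{F_1}\cdots x_{F_d}=1$ for every maximal chain of nonempty proper flats. A divisor class $\sum_Fc_Fx_F\in A^1(M)$ is combinatorially ample if there is a function $a:2^E\to\mathbb R$ with $a_\emptyset=a_E=0$, $a_F=c_F$ for all nonempty proper flats $F$, and $a_A+a_B>a_{A\cup B}+a_{A\cap B}$ for all incomparable $A,B\subseteq E$ (and $\ge$ for all $A,B$). $\mathscr K_M\subseteq A^1(M)$ is the cone of combinatorially ample classes. *)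

(* Defs.v *)
From HB Require Import structures.
From mathcomp Require Import all_boot all_order all_algebra.
From mathcomp Require Import reals.
From mathcomp Require Import mpoly.

Set Implicit Arguments.
Unset Strict Implicit.
Unset Printing Implicit Defensive.

Import Order.TTheory GRing.Theory Num.Theory.
Local Open Scope ring_scope.

Record matroid (E : finType) := Matroid {
  rk : {set E} -> nat;
  rk_ub : forall A : {set E}, (rk A <= #|A|)%N;
  rk_mono : forall A B : {set E}, A \subset B -> (rk A <= rk B)%N;
  rk_submod : forall A B : {set E}, (rk (A :|: B) + rk (A :&: B) <= rk A + rk B)%N
}.

Section MatroidDefs.
Variables (E : finType) (M : matroid E).

Definition loopless : Prop := forall e : E, rk M [set e] = 1%N.

Definition is_flat (F : {set E}) : bool :=
  [forall e, (e \notin F) ==> (rk M F < rk M (e |: F))%N].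

Definition is_pflat (F : {set E}) : bool :=
  [&& is_flat F, F != set0 & F != setT].

Definition pflat := {F : {set E} | is_pflat F}.

Definition incomparable (A B : {set E}) : bool :=
  ~~ (A \subset B) && ~~ (B \subset A).

Definition is_chain (C : {set pflat}) : bool :=
  [forall F in C, forall G in C, ~~ incomparable (val F) (val G)].

Definition max_chain (C : {set pflat}) : bool :=
  is_chain C &&
  [forall G : pflat, [forall F in C, ~~ incomparable (val F) (val G)] ==> (G \in C)].

Variable R : realType.

Definition nvar := #|{: pflat}|.
Definition polyM := {mpoly R[nvar]}.

Definition xF (F : pflat) : polyM := 'X_(enum_rank F).

Definition linrel (i j : E) : polyM :=
  \sum_(F : pflat | i \in val F) xF F - \sum_(F : pflat | j \in val F) xF F.

(* membership in the ideal generated by the x_F x_F' (F, F' incomparable)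
   and the linear relations; the generating sets are finite, so the ideal
   consists exactly of the combinations below *)
Definition inI (p : polyM) : Prop :=
  exists (a : pflat -> pflat -> polyM) (b : E -> E -> polyM),
    p = \sum_(F : pflat) \sum_(G : pflat | incomparable (val F) (val G))
           a F G * (xF F * xF G)
        + \sum_(i : E) \sum_(j : E) b i j * linrel i j.

Definition chow_eq (p q : polyM) : Prop := inI (p - q).

Definition divisor (c : pflat -> R) : polyM := \sum_(F : pflat) c F *: xF F.

Definition comb_ample_coeffs (c : pflat -> R) : Prop :=
  exists a : {set E} -> R,
    [/\ a set0 = 0, a setT = 0,
        (forall F : pflat, a (val F) = c F),
        (forall A B : {set E}, incomparable A B ->
            a (A :|: B) + a (A :&: B) < a A + a B) &
        (forall A B : {set E}, a (A :|: B) + a (A :&: B) <= a A + a B)].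

Definition in_KM (l : polyM) : Prop :=
  l \is 1.-homog /\ exists c : pflat -> R, comb_ample_coeffs c /\ chow_eq l (divisor c).

(* degree maps: linear functionals on R[x_F] vanishing on I in degree d and
   sending every maximal-chain monomial to 1 (this determines int_M on A^d(M)) *)
Definition is_degree_map (d : nat) (deg : polyM -> R) : Prop :=
  [/\ (forall (k : R) (p q : polyM), deg (k *: p + q) = k * deg p + deg q),
      (forall p : polyM, p \is d.-homog -> inI p -> deg p = 0) &
      (forall C : {set pflat}, max_chain C -> deg (\prod_(F in C) xF F) = 1)].

Definition HL_deg (d i : nat) (l : polyM) : Prop :=
  (forall x : polyM, x \is i.-homog -> inI (l ^+ (d - 2 * i) * x) -> inI x) /\
  (forall y : polyM, y \is (d - i)%N.-homog ->
     exists2 x : polyM, x \is i.-homog & chow_eq (l ^+ (d - 2 * i) * x) y).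

Definition HR_deg (d i : nat) (deg : polyM -> R) (l : polyM) : Prop :=
  forall x : polyM, x \is i.-homog ->
    inI (l ^+ (d - 2 * i + 1) * x) -> ~ inI x ->
    0 < (-1) ^+ i * deg (x * x * l ^+ (d - 2 * i)).

End MatroidDefs.

(* Main.v *)
Require Import Defs.
From HB Require Import structures.
From mathcomp Require Import all_boot all_order all_algebra.
From mathcomp Require Import reals.
From mathcomp Require Import mpoly.
From mathcomp Require Import boolp complex ring_quotient ring lra.
Set Implicit Arguments.
Unset Strict Implicit.
Unset Printing Implicit Defensive.
Import Order.TTheory GRing.Theory Num.Theory.

(* All forms are evaluated inside the Chow ring A(M) itself: the star of a chain S
   of flats is seen through the functional y |-> deg(x_S y), so no matroid minors
   are needed.  An ample class l is, for every chain S, equal to a combination of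
   the x_F that vanishes on S and is positive on the link of S: subtract from the
   submodular function the vertices of its base polytope given by the orders of E
   refining S, and average.  Hence deg(x_S l^k) > 0.

   Hodge-Riemann in degree one for the forms deg(x_S y^2 l^k), |S| = d - k - 2, goes
   by induction on k.  For k = 0 the form is negative semidefinite on a hyperplane.
   For the induction step (Bochner's method) write l = sum_F c_F x_F in the star of
   S; the form of S is then the c-combination of those of the chains S + F, and the
   reversed Cauchy-Schwarz inequalities of the latter say that a suitable weighted
   symmetric operator T satisfies T <= T^2.  Since T <= 1, with eigenvalue 1 only at
   l because the link is connected, T is nonpositive on the complement of l.
   A class in the kernel of the form pairs to zero with all chains of size d - 1;
   this says that its coefficients are additive on rank-two intervals of flats,
   hence modular, so that the class is zero.

   Surjectivity needs the dual statement that a class of degree d - 1 pairing to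
   zero with all x_F vanishes.  The class of a chain of size d - 1 depends only on its
   rank-two gap [F, K], and these gap classes form a "divisor" with values in
   A^{d-1}(M).  Integrating it over the lattice of flats gives elements xi_K with
   y = sum_K deg(x_K y) xi_K for all y of degree d - 1. *)

(** * Flats of a matroid *)

Section Flats.
Variables (E : finType) (M : matroid E).
Local Notation r := (rk M).
Local Notation flat := (is_flat M).
Implicit Types (A B F G H K : {set E}) (e : E).

Lemma flatP F : reflect (forall e, e \notin F -> (r F < r (e |: F))%N) (flat F).
Proof.
apply: (iffP forallP) => h e; first by move=> he; have := h e; rewrite he.
by apply/implyP/h.
Qed.

Lemma rk_setU1 e A : (r (e |: A) <= (r A).+1)%N.
Proof.
apply: leq_trans (_ : r (e |: A) + r ([set e] :&: A) <= _)%N; first exact: leq_addr.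
apply: leq_trans (rk_submod _ _ _) _.
by rewrite addnC -addn1 leq_add2l (leq_trans (rk_ub _ _)) // cards1.
Qed.

Lemma rk_set0 : r set0 = 0%N.
Proof. by apply/eqP; rewrite -leqn0 (leq_trans (rk_ub _ _)) // cards0. Qed.

Definition mclosure A : {set E} := [set e | r (e |: A) == r A].

Lemma sub_closure A : A \subset mclosure A.
Proof. by apply/subsetP => e eA; rewrite inE (setUidPr _) // sub1set. Qed.

(** Elements of the closure are added one at a time. Submodularity for [e |: A] and the set built so
    far, which meet in a set containing [A], shows that none of them raises the rank. *)
Lemma rk_closure A : r (mclosure A) = r A.
Proof.
suff h (s : seq E) : {subset s <= mclosure A} -> r (A :|: [set:: s]) = r A.
  have := h (enum (mclosure A)); rewrite set_enum (setUidPr (sub_closure A)); apply.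
  by move=> e; rewrite mem_enum.
elim: s => [_|e s IHs h].
  by congr (r _); apply/setP => e; rewrite !inE orbF.
have es : e \in mclosure A by apply: h; rewrite inE eqxx.
have {}IHs := IHs (fun u us => h u (@mem_behead _ (e :: s) u us)).
apply/eqP; rewrite eqn_leq; apply/andP; split; last by rewrite rk_mono ?subsetUl.
have := rk_submod M (e |: A) (A :|: [set:: s]).
rewrite IHs; move: es; rewrite inE => /eqP ->.
rewrite (_ : e |: A :|: _ = A :|: [set:: e :: s]); last first.
  by apply/setP => u; rewrite !inE; case: (u == e); case: (u \in A); rewrite /= ?orbT.
move/(leq_trans _) => le; rewrite -(leq_add2r (r A)); apply: le.
by rewrite leq_add2l rk_mono // subsetI subsetUr subsetUl.
Qed.

Lemma flat_closure A : flat (mclosure A).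
Proof.
apply/flatP => e he; rewrite rk_closure.
have lt : (r A < r (e |: A))%N.
  by rewrite ltn_neqAle rk_mono ?subsetUr // andbT eq_sym; move: he; rewrite inE.
apply: leq_trans lt _.
by rewrite rk_mono // setUS // sub_closure.
Qed.

(** By submodularity an element that does not raise the rank of [A] does not raise that of the
    larger set [F] either. *)
Lemma closure_min A F : flat F -> A \subset F -> mclosure A \subset F.
Proof.
move=> /flatP fF AF; apply/subsetP => e; rewrite inE => /eqP eA.
apply/negPn/negP => /fF; rewrite ltnNge; case/negP.
have := rk_submod M (e |: A) F; rewrite eA -setUA (setUidPr AF) => h.
rewrite -(leq_add2r (r A)) [(r F + _)%N]addnC; apply: leq_trans h.
by rewrite leq_add2l rk_mono // subsetI subsetUr AF.
Qed.

Lemma flatT : flat setT.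
Proof. by apply/flatP => e; rewrite inE. Qed.

Lemma flatI F G : flat F -> flat G -> flat (F :&: G).
Proof.
move=> fF fG; suff -> : F :&: G = mclosure (F :&: G) by exact: flat_closure.
by apply/eqP; rewrite eqEsubset sub_closure subsetI !closure_min ?subsetIl ?subsetIr.
Qed.

Lemma rk_proper F G : flat F -> F \proper G -> (r F < r G)%N.
Proof.
move=> /flatP fF /properP[FG [e eG eF]]; apply: leq_trans (fF e eF) _.
by rewrite rk_mono // subUset sub1set eG.
Qed.

Lemma flat_eq F G : flat F -> F \subset G -> (r G <= r F)%N -> F = G.
Proof.
move=> fF FG le; apply/eqP; rewrite eqEproper FG /=; apply/negP => pr.
by have := rk_proper fF pr; rewrite ltnNge le.
Qed.

Lemma rk_closureU1 F e : flat F -> e \notin F -> r (mclosure (e |: F)) = (r F).+1.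
Proof.
move=> /flatP fF /fF h; rewrite rk_closure; apply/eqP.
by rewrite eqn_leq rk_setU1 h.
Qed.

Lemma mem_closureU1 F e : e \in mclosure (e |: F).
Proof. by apply: (subsetP (sub_closure _)); rewrite !inE eqxx. Qed.

Lemma sub_closureU1 F e : F \subset mclosure (e |: F).
Proof. by apply: subset_trans (sub_closure _); rewrite subsetUr. Qed.

Lemma proper_closureU1 F e : e \notin F -> F \proper mclosure (e |: F).
Proof.
move=> eF; rewrite properE sub_closureU1; apply/negP => /subsetP/(_ e).
by rewrite mem_closureU1 (negPf eF) => /(_ isT).
Qed.

Definition atoms F H : {set {set E}} :=
  [set G | [&& flat G, F \subset G, G \subset H & r G == (r F).+1]].

Lemma atomsP F H G :
  reflect [/\ flat G, F \subset G, G \subset H & r G = (r F).+1] (G \in atoms F H).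
Proof.
by rewrite inE; apply: (iffP and4P) => -[? ? ? h]; split=> //; apply/eqP.
Qed.

Lemma closure_atom F H e : flat F -> flat H -> F \subset H -> e \in H -> e \notin F ->
  mclosure (e |: F) \in atoms F H.
Proof.
move=> fF fH FH eH eF; apply/atomsP; split; first exact: flat_closure.
- exact: sub_closureU1.
- by rewrite closure_min // subUset sub1set eH.
- exact: rk_closureU1.
Qed.

Lemma atom_proper F H G : G \in atoms F H -> F \proper G.
Proof.
case/atomsP=> _ FG _ rG; rewrite properEneq FG andbT.
by apply/eqP => eFG; move: rG; rewrite eFG => /n_Sn.
Qed.

Lemma atomE F H G e : flat F -> G \in atoms F H -> e \in G -> e \notin F ->
  mclosure (e |: F) = G.
Proof.
move=> fF /atomsP[fG FG _ rG] eG eF; apply: flat_eq; first exact: flat_closure.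
  by rewrite closure_min // subUset sub1set eG.
by rewrite rG rk_closureU1.
Qed.

(** The sets [G :\: F], for [G] covering [F] below [H], partition [H :\: F]: the block of [e] comes
    from [mclosure (e |: F)]. *)
Lemma sum_atoms (V : nmodType) (m : E -> V) F H : flat F -> flat H -> F \subset H ->
 (\sum_(G in atoms F H) \sum_(e in G :\: F) m e = \sum_(e in H :\: F) m e)%R.
Proof.
move=> fF fH FH; symmetry.
rewrite (partition_big (fun e => mclosure (e |: F)) (mem (atoms F H))) /=; last first.
  by move=> e; rewrite inE => /andP[eF eH]; apply: closure_atom.
apply: eq_bigr => G Ga; apply: eq_bigl => e; rewrite !inE.
have [_ _ GH _] := atomsP _ _ _ Ga.
case eF: (e \in F) => //=; apply/andP/idP => [[_ /eqP <-]|eG].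
  exact: mem_closureU1.
by split; [exact: (subsetP GH)|apply/eqP; apply: atomE Ga eG _; rewrite ?eF].
Qed.

(** Modular functions are additive on every interval, so subtracting one changes neither [excess]
    nor [defect] below. *)
Lemma sum_atoms_sub (V : zmodType) (m : E -> V) F H : flat F -> flat H -> F \subset H ->
  (\sum_(p in atoms F H) (\sum_(e in p) m e - \sum_(e in F) m e) =
   \sum_(e in H) m e - \sum_(e in F) m e)%R.
Proof.
move=> fF fH FH.
have h G : F \subset G ->
    (\sum_(e in G) m e - \sum_(e in F) m e = \sum_(e in G :\: F) m e)%R.
  by move=> FG; rewrite (big_setID F) /= (setIidPr FG) addrAC subrr add0r.
rewrite h // -sum_atoms //; apply: eq_bigr => p /atomsP[_ Fp _ _]; exact: h.
Qed.

Lemma atom_rank2 F H G : flat F -> flat H -> r H = (r F).+2 -> flat G ->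
  F \proper G -> G \proper H -> G \in atoms F H.
Proof.
move=> fF fH rH fG pFG pGH; apply/atomsP; split=> //; first exact: proper_sub.
  exact: proper_sub.
have := rk_proper fF pFG; have := rk_proper fG pGH; rewrite rH => h1 h2.
by apply/eqP; rewrite eqn_leq h2 andbT.
Qed.

Lemma atom_properR F H G : (r F).+1 < r H -> G \in atoms F H -> G \proper H.
Proof.
move=> h /atomsP[fG _ GH rG]; rewrite properEneq GH andbT.
by apply/eqP => eGH; move: h; rewrite -eGH rG ltnn.
Qed.

Lemma exists_flat_between F H (k : nat) : flat F -> flat H -> F \subset H ->
  (r F <= k <= r H)%N -> exists G, [/\ flat G, F \subset G, G \subset H & r G = k].
Proof.
move=> fF fH FH; elim: k => [|k IHk].
  by rewrite leqn0 => /andP[/eqP rF _]; exists F.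
rewrite leq_eqVlt => /andP[/orP[/eqP rF kH|]]; first by exists F.
rewrite ltnS => rF kH; case: IHk => [|G [fG FG GH rG]]; first by rewrite rF ltnW.
have /properP[_ [e eH eG]] : G \proper H.
  by rewrite properEneq GH andbT; apply/eqP => eGH; move: kH; rewrite -eGH rG ltnn.
exists (mclosure (e |: G)); have /atomsP[? ? ? ->] := closure_atom fG fH GH eH eG.
by rewrite rG; split=> //; apply: subset_trans FG _.
Qed.

Lemma atom_in F p H K : p \in atoms F H -> K \in atoms p H -> p \in atoms F K.
Proof.
by move=> /atomsP[fp Fp _ rp] /atomsP[_ pK _ _]; apply/atomsP.
Qed.

Lemma atom_trans F p H K : p \in atoms F K -> K \subset H -> p \in atoms F H.
Proof.
by move=> /atomsP[fp Fp pK rp] KH; apply/atomsP; split=> //; apply: subset_trans KH.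
Qed.

Lemma atomU_closure F H p q : flat F -> flat H -> p \in atoms F H -> q \in atoms F H ->
  p != q -> mclosure (p :|: q) \in atoms q H.
Proof.
move=> fF fH pA qA npq; have [fp Fp pH rp] := atomsP _ _ _ pA.
have [fq Fq qH rq] := atomsP _ _ _ qA.
have /subsetPn[e ep eq'] : ~~ (p \subset q).
  by apply: contra npq => pq; apply/eqP; apply: flat_eq => //; rewrite rp rq.
have eF : e \notin F by apply: contra eq' => /(subsetP Fq).
suff -> : mclosure (p :|: q) = mclosure (e |: q).
  by apply: closure_atom => //; apply: (subsetP pH).
apply/eqP; rewrite eqEsubset !closure_min ?flat_closure //.
  by apply: subset_trans (sub_closure _); rewrite subUset subsetUr andbT sub1set inE ep.
rewrite subUset sub_closureU1 andbT -(atomE fF pA ep eF) closure_min ?flat_closure //.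
by rewrite subUset sub1set mem_closureU1 (subset_trans Fq) // sub_closureU1.
Qed.

(** The other atoms are sorted by their join with [q], which covers [q] by [atomU_closure]. *)
Lemma sum_atoms_other (V : nmodType) (g : {set E} -> V) F H q : flat F -> flat H ->
  q \in atoms F H ->
  (\sum_(p in atoms F H | p != q) g p =
   \sum_(K in atoms q H) \sum_(p in atoms F K | p != q) g p)%R.
Proof.
move=> fF fH qA; rewrite (partition_big (fun p => mclosure (p :|: q)) (mem (atoms q H))) /=.
  apply: eq_bigr => K KA; apply: eq_bigl => p.
  have [fK qK KH rK] := atomsP _ _ _ KA.
  apply/andP/andP => [[/andP[pA npq] /eqP eK]|[pK npq]].
    split=> //; have [fp Fp pH rp] := atomsP _ _ _ pA; apply/atomsP; split=> //.
    by rewrite -eK; apply: subset_trans (sub_closure _); apply: subsetUl.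
  have pA := atom_trans pK KH; split; first by rewrite pA.
  have [fp Fp pK' rp] := atomsP _ _ _ pK.
  have /atomsP[fc _ _ rc] := atomU_closure fF fH pA qA npq.
  apply/eqP/flat_eq => //; last by rewrite rc rK.
  by rewrite closure_min // subUset pK'.
by move=> p /andP[pA npq]; apply: (atomU_closure fF fH pA qA).
Qed.

Lemma atoms_rank1 F H : flat F -> flat H -> F \subset H -> r H = (r F).+1 ->
  atoms F H = [set H].
Proof.
move=> fF fH FH rH; apply/setP => G; rewrite [RHS]inE.
apply/atomsP/eqP => [[fG _ GH rG]|->]; last by split.
by apply: flat_eq => //; rewrite rG rH.
Qed.

(** Additivity propagates from rank-two intervals. Fix an atom [q] and group the others by their
    join [K] with [q]: the rank-two case turns the group of [K] into [g K - g q], which leaves the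
    claim for the interval from [q] to [H]. *)
Lemma atoms_additive (V : zmodType) (g : {set E} -> V) :
  (forall F H, flat F -> flat H -> F \subset H -> r H = (r F).+2 ->
    \sum_(p in atoms F H) (g p - g F) = g H - g F)%R ->
  forall n F H, flat F -> flat H -> F \subset H -> r H = (r F + n.+1)%N ->
    (\sum_(p in atoms F H) (g p - g F) = g H - g F)%R.
Proof.
move=> h2; elim=> [|n IHn] F H fF fH FH rH.
  by rewrite atoms_rank1 ?big_set1 // rH addn1.
have [q [fq Fq qH rq]] : exists q, [/\ flat q, F \subset q, q \subset H & r q = (r F).+1].
  by apply: exists_flat_between => //; rewrite leqnSn rH addnS ltnS leq_addr.
have qA : q \in atoms F H by apply/atomsP.
rewrite (bigD1 q) //= (sum_atoms_other _ fF fH qA).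
transitivity (g q - g F + \sum_(K in atoms q H) (g K - g q))%R.
  congr (_ + _)%R; apply: eq_bigr => K KA; have [fK qK KH rK] := atomsP _ _ _ KA.
  have := h2 F K fF fK (subset_trans Fq qK); rewrite rK rq => /(_ erefl).
  rewrite (bigD1 q) /=; last exact: atom_in KA.
  by move=> e; apply: (addrI (g q - g F)%R); rewrite e [RHS]addrC addrA subrK.
by rewrite IHn // ?rq ?rH ?addSnnS // addrC addrA subrK.
Qed.

End Flats.

(** * Chains of flats and their links *)

Definition cmp (E : finType) (A B : {set E}) := (A \subset B) || (B \subset A).

Lemma cmpC (E : finType) (A B : {set E}) : cmp A B = cmp B A.
Proof. exact: orbC. Qed.

Lemma cmpNinc (E : finType) (A B : {set E}) : incomparable A B = ~~ cmp A B.
Proof. by rewrite negb_or. Qed.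

Section Chains.
Variables (E : finType) (M : matroid E) (d : nat).
Hypotheses (loopM : loopless M) (rkT : rk M setT = d.+1).
Local Notation r := (rk M).
Local Notation flat := (is_flat M).
Local Notation pfl := (is_pflat M).
Implicit Types (A B F G H K L U : {set E}) (S : {set {set E}}) (e : E).

Lemma flat0 : flat set0.
Proof. by apply/flatP => e _; rewrite rk_set0 setU0 loopM. Qed.

Lemma pflatP F : reflect [/\ flat F, set0 \proper F & F \proper setT] (pfl F).
Proof.
rewrite proper0 properT; exact: and3P.
Qed.

Lemma pflat_flat F : pfl F -> flat F.
Proof. by case/pflatP. Qed.

Lemma pflat_rk F : pfl F -> (0 < r F <= d)%N.
Proof.
case/pflatP=> fF p0 p1; have := rk_proper flat0 p0; have := rk_proper fF p1.
by rewrite rk_set0 rkT ltnS => -> ->.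
Qed.

Lemma rk_pflat F : flat F -> (0 < r F <= d)%N -> pfl F.
Proof.
move=> fF h; rewrite /is_pflat fF /=; apply/andP; split; apply/eqP => eF; move: h.
  by rewrite eF rk_set0.
by rewrite eF rkT ltnn andbF.
Qed.

Lemma cmp_rk F G : flat F -> flat G -> cmp F G -> (r F <= r G)%N -> F \subset G.
Proof.
move=> fF fG /orP[//|GF] le; by rewrite (flat_eq fG GF le).
Qed.

Lemma cmp_rk_proper F G : flat F -> flat G -> cmp F G -> (r F < r G)%N -> F \proper G.
Proof.
move=> fF fG FG lt; rewrite properEneq (cmp_rk fF fG FG (ltnW lt)) andbT.
by apply: contraTneq lt => ->; rewrite ltnn.
Qed.

Definition chain S :=
  [forall F in S, pfl F] && [forall F in S, forall G in S, cmp F G].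

Lemma chainP S :
  reflect ({in S, forall F, pfl F} /\ {in S &, forall F G, cmp F G}) (chain S).
Proof.
apply: (iffP andP) => -[h1 h2]; split.
- by move=> F FS; apply: (forall_inP h1).
- by move=> F G FS GS; apply: (forall_inP (forall_inP h2 F FS)).
- exact/forall_inP.
- by apply/forall_inP => F FS; apply/forall_inP => G GS; apply: h2.
Qed.

(** The vertices of the link of [S] in the order complex of the nonempty proper flats. *)
Definition lk S := [set G | [&& pfl G, G \notin S & [forall F in S, cmp F G]]].

Lemma lkP S G : reflect [/\ pfl G, G \notin S & {in S, forall F, cmp F G}] (G \in lk S).
Proof.
rewrite inE; apply: (iffP and3P) => -[h1 h2 h3]; split=> //.
  by move=> F FS; apply: (forall_inP h3).
exact/forall_inP.
Qed.

Lemma chain0 : chain set0.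
Proof. by apply/chainP; split=> F; rewrite inE. Qed.

Lemma lk0 F : (F \in lk set0) = pfl F.
Proof.
by apply/lkP/idP => [[]//|pF]; split=> //; [rewrite inE|move=> G; rewrite inE].
Qed.

Lemma chainU1 S G : chain S -> G \in lk S -> chain (G |: S).
Proof.
move=> /chainP[h1 h2] /lkP[pG GS hG]; apply/chainP; split.
  by move=> F /setU1P[->|/h1].
move=> F K /setU1P[->|FS] /setU1P[->|KS]; first by rewrite /cmp subxx.
- by rewrite cmpC hG.
- exact: hG.
- exact: h2.
Qed.

Lemma card_lkU1 S G : G \in lk S -> #|G |: S| = #|S|.+1.
Proof. by case/lkP=> _ GS _; rewrite cardsU1 GS. Qed.

Lemma chainS S S' : S' \subset S -> chain S -> chain S'.
Proof.
move=> /subsetP sub /chainP[h1 h2]; apply/chainP; split=> [F /sub/h1 //|].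
by move=> F G /sub FS /sub GS; apply: h2.
Qed.

Lemma lk_of_chain S G : chain S -> G \in S -> G \in lk (S :\ G).
Proof.
move=> /chainP[h1 h2] GS; apply/lkP; split; [exact: h1|by rewrite !inE eqxx|].
by move=> F; rewrite !inE => /andP[_ FS]; apply: h2.
Qed.

Lemma lk_setU1 S G H : G \in lk (H |: S) -> G \in lk S.
Proof.
case/lkP=> pG GS h; apply/lkP; split=> //.
  by apply: contra GS => GS; rewrite inE GS orbT.
by move=> F FS; apply: h; rewrite inE FS orbT.
Qed.

Lemma in_lk_setU1 S G H : G \in lk S -> G != H -> cmp H G -> G \in lk (H |: S).
Proof.
case/lkP=> pG GS h nGH c; apply/lkP; split=> //.
  by rewrite !inE negb_or nGH.
by move=> F /setU1P[->|/h].
Qed.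

(** With both ends added, every flat of the link lies between two consecutive members. *)
Definition ext S : {set {set E}} := set0 |: (setT |: S).

Lemma ext_flat S F : chain S -> F \in ext S -> flat F.
Proof.
move=> /chainP[h _]; rewrite !inE => /or3P[/eqP->|/eqP->|/h/pflat_flat //].
  exact: flat0.
exact: flatT.
Qed.

Lemma ext_cmp S F G : chain S -> F \in ext S -> G \in ext S -> cmp F G.
Proof.
move=> /chainP[_ h]; rewrite !inE /cmp.
case/or3P=> [/eqP->|/eqP->|FS]; rewrite ?sub0set ?subsetT ?orbT //.
case/or3P=> [/eqP->|/eqP->|GS]; rewrite ?sub0set ?subsetT ?orbT //.
exact: h.
Qed.

Lemma in_ext0 S : set0 \in ext S. Proof. by rewrite !inE eqxx. Qed.
Lemma in_extT S : setT \in ext S. Proof. by rewrite !inE eqxx orbT. Qed.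
Lemma in_extS S F : F \in S -> F \in ext S. Proof. by rewrite !inE => ->; rewrite !orbT. Qed.

(** [L] and [U] are consecutive in the chain [ext S]; they bound a gap of [S]. *)
Definition adjacent S L U :=
  [/\ L \in ext S, U \in ext S, L \proper U &
      {in ext S, forall F, (F \subset L) || (U \subset F)}].

Lemma gap_rk S t : chain S -> (0 < t <= d)%N -> {in S, forall F, r F != t} ->
  exists L U, adjacent S L U /\ (r L < t < r U)%N.
Proof.
move=> cS /andP[t0 td] nS.
have P0 : (set0 \in ext S) && (r set0 < t)%N by rewrite in_ext0 rk_set0.
have PT : (setT \in ext S) && (t < r setT)%N by rewrite in_extT rkT ltnS.
case: (@arg_maxnP _ set0 (fun F => (F \in ext S) && (r F < t)%N) r P0) => L /andP[LS Lt] Lmax.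
case: (@arg_minnP _ setT (fun F => (F \in ext S) && (t < r F)%N) r PT) => U /andP[US Ut] Umin.
exists L, U; split; last by rewrite Lt.
have fL := ext_flat cS LS; have fU := ext_flat cS US.
split=> //.
  by apply: cmp_rk_proper (ext_cmp cS LS US) _ => //; apply: ltn_trans Lt Ut.
move=> F FS; have fF := ext_flat cS FS.
have : (r F != t).
  move: FS; rewrite !inE => /or3P[/eqP->|/eqP->|/nS //].
    by rewrite rk_set0 eq_sym -lt0n.
  by rewrite rkT neq_ltn orbC ltnS td.
rewrite neq_ltn => /orP[lt|lt]; apply/orP; [left|right].
  by apply: cmp_rk (ext_cmp cS FS LS) _ => //; apply: Lmax; rewrite FS.
by apply: cmp_rk (ext_cmp cS US FS) _ => //; apply: Umin; rewrite FS.
Qed.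

Lemma lk_between S L U G : adjacent S L U -> flat G -> L \proper G -> G \proper U ->
  G \in lk S.
Proof.
case=> LS US LU adj fG LG GU; apply/lkP; split.
- apply/pflatP; split=> //; first exact: sub_proper_trans (sub0set _) LG.
  exact: proper_sub_trans GU (subsetT _).
- apply/negP => /in_extS /adj /orP[GL|UG].
    by move: LG; rewrite properE GL andbF.
  by move: GU; rewrite properE UG andbF.
- move=> F /in_extS/adj /orP[FL|UF]; rewrite /cmp.
    by rewrite (subset_trans FL (proper_sub LG)).
  by rewrite (subset_trans (proper_sub GU) UF) orbT.
Qed.

(** A flat of the link shares its rank with no member of [S], because comparable flats of equal rank
    coincide; so its rank falls into a gap. *)
Lemma lk_gap S G : chain S -> G \in lk S ->
  exists L U, [/\ adjacent S L U, L \proper G & G \proper U].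
Proof.
move=> cS /lkP[pG GS hG]; have fG := pflat_flat pG.
have [|L [U [adj /andP[lt1 lt2]]]] := gap_rk cS (pflat_rk pG).
  move=> F FS; apply: contraNneq GS => eFG.
  have fF : flat F by apply: (ext_flat cS); apply: in_extS.
  by rewrite -(flat_eq fF (cmp_rk fF fG (hG _ FS) _)) // eFG.
have hG' F : F \in ext S -> cmp F G.
  rewrite !inE => /or3P[/eqP->|/eqP->|/hG //]; rewrite /cmp ?sub0set //.
  by rewrite subsetT orbT.
exists L, U; split=> //; have [LS US _ _] := adj.
  by apply: cmp_rk_proper lt1 => //; [exact: ext_flat cS LS|exact: hG'].
by apply: cmp_rk_proper lt2 => //; [exact: ext_flat cS US|rewrite cmpC hG'].
Qed.

(** The rank embeds a chain into [1, ..., d]. This bounds its size, and a chain of size [d] takes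
    every rank. *)
Lemma chain_rks S : chain S ->
  uniq [seq r F | F <- enum S] /\ {subset [seq r F | F <- enum S] <= iota 1 d}.
Proof.
move=> /chainP[h1 h2]; split.
  rewrite map_inj_in_uniq ?enum_uniq // => F G; rewrite !mem_enum => FS GS /= e.
  have fF := pflat_flat (h1 _ FS); have fG := pflat_flat (h1 _ GS).
  apply: (flat_eq fF); last by rewrite e.
  by apply: cmp_rk => //; [apply: h2|rewrite e].
move=> t /mapP[F]; rewrite mem_enum => /h1/pflat_rk h ->.
by rewrite mem_iota add1n ltnS.
Qed.

Lemma card_chain S : chain S -> (#|S| <= d)%N.
Proof.
move=> /chain_rks[u sub]; have := uniq_leq_size u sub.
by rewrite size_map size_iota -cardE.
Qed.

Lemma chain_hit S t : chain S -> #|S| = d -> (0 < t <= d)%N -> exists2 F, F \in S & r F = t.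
Proof.
move=> /chain_rks[u sub] cS ht; have [|_ h] := uniq_min_size u sub.
  by rewrite size_map size_iota -cardE cS.
have : t \in iota 1 d by rewrite mem_iota add1n ltnS.
by rewrite -h => /mapP[F]; rewrite mem_enum => FS ->; exists F.
Qed.

Lemma lk_ex S : chain S -> (#|S| < d)%N -> exists G, G \in lk S.
Proof.
move=> cS lt.
have [/allP h|/allPn[t]] := boolP (all (mem [seq r F | F <- enum S]) (iota 1 d)).
  have := uniq_leq_size (iota_uniq 1 d) h.
  by rewrite size_map size_iota -cardE leqNgt lt.
rewrite mem_iota add1n ltnS => td /= tS.
have [|L [U [adj /andP[lt1 lt2]]]] := gap_rk cS td.
  move=> F FS; apply: contraNneq tS => <-.
  by apply/mapP; exists F; rewrite ?mem_enum.
have [LS US /properP[_ [e eU eL]] _] := adj.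
have fL := ext_flat cS LS.
exists (mclosure M (e |: L)); apply: (lk_between adj).
- exact: flat_closure.
- exact: proper_closureU1.
- have /orP[UL|_] := (let: And4 _ _ _ h := adj in h U US).
    by move: eL; rewrite (subsetP UL).
  have LU : L \subset U by case: adj => _ _ /proper_sub.
  apply: (@cmp_rk_proper (mclosure M (e |: L)) U); first exact: flat_closure.
  + exact: ext_flat cS US.
  + by apply/orP; left; case/atomsP: (closure_atom fL (ext_flat cS US) LU eU eL).
  + by rewrite rk_closureU1 //; apply: leq_ltn_trans lt2.
Qed.

(* [W] below is the join of atoms below [F] and below [G]; the rank hypothesis
   keeps it inside the gap, unless the gap has rank two, in which case an
   element of the link outside the gap is comparable to both. *)
Lemma lk_connected (V : Type) (f : {set E} -> V) S : chain S -> (#|S|.+2 <= d)%N ->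
  {in lk S &, forall F G, cmp F G -> f F = f G} ->
  {in lk S &, forall F G, f F = f G}.
Proof.
move=> cS cardS hf F G FS GS.
have [/hf->//|] := boolP (cmp F G); rewrite negb_or => /andP[nFG nGF].
have [pF _ cF] := lkP _ _ FS; have [pG _ cG] := lkP _ _ GS.
have fF := pflat_flat pF; have fG := pflat_flat pG.
set L := F :&: G; set U := mclosure M (F :|: G).
have fL : flat L := flatI fF fG.
have fU : flat U := flat_closure M _.
have FU : F \subset U by apply: subset_trans (sub_closure _ _); rewrite subsetUl.
have GU : G \subset U by apply: subset_trans (sub_closure _ _); rewrite subsetUr.
(* No member of [S] separates [F] from [G]: one lying above the first and below the second would
   make them comparable. *)
have cK T : T \in S -> (T \subset L) || (U \subset T).
  move=> TS; have fT : flat T by apply: (ext_flat cS); apply: in_extS.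
  have /orP[TF|FT] := cF _ TS; have /orP[TG|GT] := cG _ TS.
  - by rewrite subsetI TF TG.
  - by move: nGF; rewrite (subset_trans GT TF).
  - by move: nFG; rewrite (subset_trans FT TG).
  - by rewrite (closure_min fT) ?orbT // subUset FT GT.
have cmpS K : L \subset K -> K \subset U -> {in S, forall T, cmp T K}.
  move=> LK KU T /cK /orP[TL|UT]; rewrite /cmp; first by rewrite (subset_trans TL LK).
  by rewrite (subset_trans KU UT) orbT.
have btw K : flat K -> L \proper K -> K \proper U -> K \in lk S.
  move=> fK LK KU; apply/lkP; split.
  - apply/pflatP; split=> //; first exact: sub_proper_trans (sub0set _) LK.
    exact: proper_sub_trans KU (subsetT _).
  - apply/negP => /cK /orP[KL|UK].
      by move: LK; rewrite properE KL andbF.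
    by move: KU; rewrite properE UK andbF.
  - by apply: cmpS; exact: proper_sub.
have LF : L \proper F.
  rewrite properEneq subsetIl andbT; apply: contra nFG => /eqP <-; exact: subsetIr.
have LG : L \proper G.
  rewrite properEneq subsetIr andbT; apply: contra nGF => /eqP <-; exact: subsetIl.
have pFU : F \proper U.
  by rewrite properEneq FU andbT; apply: contraNneq nGF => ->.
have pGU : G \proper U.
  by rewrite properEneq GU andbT; apply: contraNneq nFG => ->.
have [le|gt] := leqP (r L).+3 (r U).
  have /properP[_ [e eF eL]] := LF; have /properP[_ [e' eG eL']] := LG.
  set F' := mclosure M (e |: L); set G' := mclosure M (e' |: L).
  set W := mclosure M (e |: G').
  have fG' : flat G' := flat_closure M _.
  have rG' : r G' = (r L).+1 := rk_closureU1 fL eL'.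
  have G'U : G' \subset G.
    by rewrite closure_min // subUset sub1set eG subsetIr.
  have F'F : F' \subset F by rewrite closure_min // subUset sub1set eF subsetIl.
  have LG' : L \proper G' := proper_closureU1 _ eL'.
  have LF' : L \proper F' := proper_closureU1 _ eL.
  have G'W : G' \subset W by apply: sub_closureU1.
  have F'W : F' \subset W.
    rewrite closure_min ?flat_closure // subUset sub1set mem_closureU1 /=.
    exact: subset_trans (proper_sub LG') G'W.
  have WU : W \proper U.
    have WsU : W \subset U.
      rewrite closure_min // subUset sub1set (subsetP FU) //=.
      exact: subset_trans G'U GU.
    rewrite properEneq WsU andbT; apply: contraTneq le => <-.
    by rewrite rk_closure -ltnNge ltnS -rG' rk_setU1.
  have F'S : F' \in lk S.
    by apply: btw; [exact: flat_closure| |exact: sub_proper_trans F'F pFU].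
  have G'S : G' \in lk S.
    by apply: btw; [exact: flat_closure| |exact: sub_proper_trans G'U pGU].
  have WS : W \in lk S.
    by apply: btw; [exact: flat_closure|exact: proper_sub_trans LG' G'W|].
  rewrite (hf F F') // /cmp ?F'F ?orbT // (hf F' W) // /cmp ?F'W //.
  by rewrite (hf W G') // /cmp ?G'W ?orbT // (hf G' G) // /cmp G'U.
have FUc : cmp F U by rewrite /cmp FU.
have GUc : cmp U G by rewrite /cmp GU orbT.
have [US|nU] := boolP (U \in lk S); first by rewrite (hf F U) // (hf U G).
have LFc : cmp F L by rewrite /cmp subsetIl orbT.
have LGc : cmp L G by rewrite /cmp subsetIr.
have [LS|nL] := boolP (L \in lk S); first by rewrite (hf F L) // (hf L G).
(* [L] and [U] are now both outside the link, hence in [ext S]; so a flat [H] of the link of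
   [F |: S] lies below [L] or above [U] and is comparable to [G]. *)
have extS K : flat K -> L \subset K -> K \subset U -> K \notin lk S -> K \in ext S.
  move=> fK LK KU; apply: contraR; rewrite !inE !negb_or => /and3P[n0 nT nS].
  rewrite /is_pflat fK n0 nT nS /=; apply/forall_inP; exact: cmpS.
have [H HS] : exists H, H \in lk (F |: S).
  by apply: lk_ex (chainU1 cS FS) _; rewrite card_lkU1.
have [pH nH cH] := lkP _ _ HS; have HlS := lk_setU1 HS.
have fH := pflat_flat pH.
have cFH : cmp F H by apply: cH; rewrite !inE eqxx.
have nHF : H != F by apply: contra nH => /eqP->; rewrite !inE eqxx.
have cHe K : K \in ext S -> cmp K H.
  rewrite !inE => /or3P[/eqP->|/eqP->|KS]; rewrite /cmp ?sub0set ?subsetT ?orbT //.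
  by apply: cH; rewrite inE KS orbT.
have LU : L \subset U := subset_trans (subsetIl _ _) FU.
rewrite (hf F H) //; apply: (hf H G) => //.
have rLF := rk_proper fL LF; have rFU := rk_proper fF pFU.
case/orP: cFH => [FH|HF].
  have pFH : F \proper H by rewrite properEneq FH andbT eq_sym.
  have rFH := rk_proper fF pFH.
  have UH : U \subset H.
    apply: cmp_rk (cHe _ (extS _ fU LU _ nU)) _ => //.
    exact: leq_trans (leq_trans (gt : r U <= (r L).+2) (rLF : (r L).+2 <= (r F).+1)) rFH.
  by rewrite /cmp (subset_trans GU UH) orbT.
have pHF : H \proper F by rewrite properEneq HF andbT.
have rHF := rk_proper fH pHF.
have HL : H \subset L.
  apply: cmp_rk => //; last exact: leq_trans (rHF : (r H).+2 <= (r F).+1) (leq_trans rFU gt).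
  by rewrite cmpC; apply: cHe (extS _ fL _ LU nL).
by rewrite /cmp (subset_trans HL) ?subsetIr.
Qed.

Lemma chain_extend S : chain S -> exists T, [/\ chain T, S \subset T & #|T| = d].
Proof.
have [n] := ubnP (d - #|S|); elim: n S => // n IHn S lt cS.
have := card_chain cS; rewrite leq_eqVlt => /orP[/eqP eS|ltS]; first by exists S.
have [F FS] := lk_ex cS ltS.
have [|T [cT ST eT]] := IHn _ _ (chainU1 cS FS).
  by rewrite (card_lkU1 FS) subnS -ltnS prednK ?subn_gt0.
by exists T; split=> //; apply: subset_trans (subsetUr _ _) ST.
Qed.

Lemma lk_ext_cmp S F G : F \in lk S -> G \in ext S -> cmp G F.
Proof.
move=> /lkP[_ _ h]; rewrite !inE /cmp => /or3P[/eqP->|/eqP->|/h //].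
  by rewrite sub0set.
by rewrite subsetT orbT.
Qed.

Lemma atom_of_rank S L U K : chain S -> adjacent S L U -> ((r L).+1 < r U)%N ->
  K \in lk S -> r K = (r L).+1 -> K \in atoms M L U.
Proof.
move=> cS [LS US _ _] lt KS rK; have fK : flat K by case/lkP: KS => /pflat_flat.
apply/atomsP; split=> //.
  by apply: (cmp_rk (ext_flat cS LS) fK (lk_ext_cmp KS LS)); rewrite rK.
apply: (cmp_rk fK (ext_flat cS US)); first by rewrite cmpC (lk_ext_cmp KS US).
by rewrite rK ltnW.
Qed.

(** A full chain must hit the rank between [L] and [U], and only the added flat can have it. *)
Lemma lk_rank2 S L U : chain S -> #|S|.+1 = d -> adjacent S L U -> r U = (r L).+2 ->
  lk S = atoms M L U.
Proof.
move=> cS cardS adj rU; have [LS US _ adjF] := adj.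
have fL := ext_flat cS LS; have fU := ext_flat cS US.
apply/setP => F; apply/idP/idP => [FS|FA].
  apply: (atom_of_rank cS adj) => //; first by rewrite rU.
  have rUd : (r U <= d.+1)%N by rewrite -rkT rk_mono ?subsetT.
  have [||K /setU1P[->//|KS] rK] := chain_hit (t := (r L).+1) (chainU1 cS FS).
  - by rewrite (card_lkU1 FS).
  - by rewrite /= -(ltnS _ d) -rU.
  - have /orP[KL|UK] := adjF K (in_extS KS).
      by have := rk_mono M KL; rewrite rK ltnn.
    by have := rk_mono M UK; rewrite rK rU ltnn.
apply: (lk_between adj); [by case/atomsP: FA|exact: atom_proper FA|].
by apply: atom_properR FA; rewrite rU.
Qed.

Lemma cmpT F : cmp F F. Proof. by rewrite /cmp subxx. Qed.

(** The filter drops an end equal to [set0] or [setT], which cannot belong to a chain. *)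
Definition ends F K : {set {set E}} := [set G in [set F; K] | pfl G].

Lemma chain_ends F K : F \subset K -> chain (ends F K).
Proof.
move=> FK; apply/chainP; split=> [G|G H]; first by rewrite inE => /andP[].
rewrite !inE => /andP[/orP[]/eqP-> _] /andP[/orP[]/eqP-> _]; rewrite ?cmpT //.
  by rewrite /cmp FK.
by rewrite /cmp FK orbT.
Qed.

Lemma adjacent_ends F K : flat F -> flat K -> F \proper K -> adjacent (ends F K) F K.
Proof.
move=> fF fK FK.
have inext G : flat G -> G \in [set F; K] -> G \in ext (ends F K).
  move=> fG GFK; have [pG|npG] := boolP (pfl G).
    by apply: in_extS; rewrite !inE in GFK *; rewrite GFK.
  by move: npG; rewrite /is_pflat fG /= negb_and !negbK => h; rewrite !inE orbA h.
split=> //; try by apply: inext; rewrite ?inE ?eqxx ?orbT.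
move=> G; rewrite !inE => /or3P[/eqP->|/eqP->|]; rewrite ?sub0set ?subsetT ?orbT //.
by case/andP=> /orP[]/eqP-> _; rewrite subxx ?orbT.
Qed.

Lemma adjacentU1 S F K (p : {set E}) : adjacent S F K -> F \proper p -> p \proper K ->
  adjacent (p |: S) F p /\ adjacent (p |: S) p K.
Proof.
move=> [FS KS FK adj] Fp pK.
have sub G : G \in ext S -> G \in ext (p |: S) by rewrite !inE => /or3P[]->; rewrite ?orbT.
have inv G : G \in ext (p |: S) -> G = p \/ G \in ext S.
  by rewrite !inE => /or4P[->|->|/eqP->|->]; rewrite ?orbT; [right|right|left|right].
have pS : p \in ext (p |: S) by rewrite !inE eqxx !orbT.
split; split; rewrite ?(sub _ FS) ?(sub _ KS) //.
  move=> G /inv[->|/adj/orP[->//|KG]]; first by rewrite subxx orbT.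
  by rewrite (subset_trans (proper_sub pK) KG) orbT.
move=> G /inv[->|/adj/orP[GF|->]]; rewrite ?subxx ?orbT //.
by rewrite (subset_trans GF (proper_sub Fp)).
Qed.

(** Take a full chain through both ends and remove its member of the middle rank. *)
Lemma interval_chain L U : flat L -> flat U -> L \subset U -> r U = (r L).+2 ->
  exists S, [/\ chain S, #|S|.+1 = d & adjacent S L U].
Proof.
move=> fL fU LU rU; have cS0 := chain_ends LU.
have [T [cT /subsetP ST cardT]] := chain_extend cS0.
have rUd : (r U <= d.+1)%N by rewrite -rkT rk_mono ?subsetT.
have [|K KT rK] := chain_hit (t := (r L).+1) cT cardT; first by rewrite /= -(ltnS _ d) -rU.
have cTK : chain (T :\ K) by apply: chainS cT; apply: subD1set.
have inext F : flat F -> F \in [set L; U] -> F != K -> F \in ext (T :\ K).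
  move=> fF FLU nFK; have [pF|npF] := boolP (pfl F).
    by apply: in_extS; rewrite !inE nFK ST // inE FLU.
  by move: npF; rewrite /is_pflat fF /= negb_and !negbK => h; rewrite !inE orbA h.
have LS : L \in ext (T :\ K).
  apply: inext; rewrite ?inE ?eqxx //; apply: contra_eqN rK => /eqP->.
  by rewrite neq_ltn ltnSn.
have US : U \in ext (T :\ K).
  apply: inext; rewrite ?inE ?eqxx ?orbT //; apply: contra_eqN rK => /eqP<-.
  by rewrite neq_ltn rU ltnSn orbT.
exists (T :\ K); split=> //; first by rewrite -cardT (cardsD1 K T) KT.
have pLU : L \proper U.
  by rewrite properEneq LU andbT; apply: contra_eqN rU => /eqP->; rewrite neq_ltn ltnW.
split=> // F FS; have fF := ext_flat cTK FS.
have cFL := ext_cmp cTK FS LS; have cFU := ext_cmp cTK US FS.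
have [le|lt] := leqP (r F) (r L); first by rewrite (cmp_rk fF fL).
have [le|lt'] := leqP (r U) (r F); first by rewrite (cmp_rk fU fF) ?orbT.
have rF : r F = r K by apply/eqP; rewrite rK eqn_leq lt andbT -ltnS -rU.
have fK : flat K by case/chainP: cT => h _; apply: pflat_flat (h _ KT).
move: FS; rewrite !inE => /or3P[/eqP eF|/eqP eF|/andP[nFK FT]].
- by rewrite eF sub0set.
- by rewrite eF subsetT orbT.
case/eqP: nFK; apply: (flat_eq fF); last by rewrite rF.
by apply: (cmp_rk fF fK); [case/chainP: cT => _; apply|rewrite rF].
Qed.

Lemma interval_chain3 F K : flat F -> flat K -> F \subset K -> r K = (r F).+3 ->
  exists S, [/\ chain S, #|S|.+2 = d & adjacent S F K].
Proof.
move=> fF fK FK rK.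
have pFK : F \proper K.
  by rewrite properEneq FK andbT; apply: contra_eqN rK => /eqP->; rewrite neq_ltn !ltnS leqW.
have [p [fp Fp pK rp]] : exists p, [/\ flat p, F \subset p, p \subset K & r p = (r F).+1].
  by apply: (exists_flat_between fF fK FK); rewrite leqnSn rK !ltnS leqW.
have [q [fq pq qK rq]] : exists q, [/\ flat q, p \subset q, q \subset K & r q = (r p).+1].
  by apply: (exists_flat_between fp fK pK); rewrite leqnSn rK rp leqnSn.
have pA : p \in atoms M F K by apply/atomsP.
have qA : q \in atoms M p K by apply/atomsP.
have pFp := atom_proper pA; have ppq := atom_proper qA.
have ppK : p \proper K by apply: atom_properR pA; rewrite rK !ltnS.
have pqK : q \proper K by apply: atom_properR qA; rewrite rK rp !ltnS.
have adj0 := adjacent_ends fF fK pFK; have cS0 := chain_ends FK.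
have pl := lk_between adj0 fp pFp ppK.
have [_ adj1] := adjacentU1 adj0 pFp ppK; have cS1 := chainU1 cS0 pl.
have ql := lk_between adj1 fq ppq pqK; have cS2 := chainU1 cS1 ql.
have [T [cT /subsetP ST cardT]] := chain_extend cS2.
have pT : p \in T by apply: ST; rewrite !inE eqxx !orbT.
have qT : q \in T by apply: ST; rewrite !inE eqxx.
have nqp : q != p by apply: contraTneq ppq => ->; rewrite properxx.
have cT0 : chain (T :\ p :\ q).
  by apply: chainS cT; rewrite (subset_trans (subD1set _ _)) // subD1set.
exists (T :\ p :\ q); split=> //.
  by rewrite -cardT (cardsD1 p T) pT (cardsD1 q (T :\ p)) !inE nqp qT.
have inT G : G \in ext (ends F K) -> G \in [set F; K] -> G \in ext (T :\ p :\ q).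
  rewrite !inE => /or3P[->|->|]; rewrite ?orbT // => /andP[_ pG] GFK.
  rewrite ST ?inE ?GFK ?pG ?orbT // andbT.
  suff [-> ->] : G != q /\ G != p by rewrite !orbT.
  by case/orP: GFK => /eqP->; split; apply: contraTneq (isT) => e;
    [move: (proper_trans pFp ppq)|move: pFp|move: pqK|move: ppK]; rewrite e properxx.
have [FS KS _ _] := adj0.
have FT : F \in ext (T :\ p :\ q) by apply: inT; rewrite // !inE eqxx.
have KT : K \in ext (T :\ p :\ q) by apply: inT; rewrite // !inE eqxx orbT.
split=> // G GT; have fG := ext_flat cT0 GT.
have cGF := ext_cmp cT0 GT FT; have cGK := ext_cmp cT0 GT KT.
have [le|lt] := leqP (r G) (r F); first by rewrite (cmp_rk fG fF).
have [le|lt'] := leqP (r K) (r G); first by rewrite cmpC in cGK; rewrite (cmp_rk fK fG) ?orbT.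
have same H : H \in T -> flat H -> r G = r H -> G \in T -> G = H.
  move=> HT fH rGH GT'; apply: (flat_eq fG); last by rewrite rGH.
  by apply: (cmp_rk fG fH); [case/chainP: cT => _; apply|rewrite rGH].
move: GT; rewrite !inE => /or3P[/eqP->|/eqP->|/and3P[nq np GT]].
- by rewrite sub0set.
- by rewrite subsetT orbT.
have : (r G == (r F).+1) || (r G == (r F).+2).
  move: lt'; rewrite rK ltnS leq_eqVlt => /orP[->|]; first by rewrite orbT.
  by rewrite ltnS => le; rewrite eqn_leq le lt.
rewrite -rp -rq; case/orP => /eqP rG.
  by rewrite (same p) ?eqxx in np.
by rewrite (same q) ?eqxx in nq.
Qed.

End Chains.

(** * Modular functions below a submodular function *)

Local Open Scope ring_scope.

Section Greedy.
Variables (E : finType) (R : realFieldType) (rho : E -> nat) (a : {set E} -> R).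
Hypotheses (rho_inj : injective rho) (a0 : a set0 = 0).
Implicit Types (A : {set E}) (e u : E).

Definition before e := [set u | (rho u < rho e)%N].
(** For submodular [a] this is the vertex of the base polytope that Edmonds' greedy algorithm yields
    for the order [rho]. *)
Definition greedy e : R := a (e |: before e) - a (before e).
Definition initial A := forall e u, e \in A -> (rho u < rho e)%N -> u \in A.

Lemma last_elt A : A != set0 -> exists2 e, e \in A & A :\ e \subset before e.
Proof.
case/set0Pn=> e0 Ae0; case: (@arg_maxnP _ e0 (mem A) rho Ae0) => e eA emax.
exists e => //; apply/subsetP => u; rewrite !inE => /andP[ue uA].
rewrite ltn_neqAle (emax u uA : (rho u <= rho e)%N) andbT.
by apply: contra ue => /eqP/rho_inj->.
Qed.

Lemma initial_last A e : initial A -> e \in A -> A :\ e \subset before e ->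
  A :\ e = before e.
Proof.
move=> iA eA sub; apply/eqP; rewrite eqEsubset sub; apply/subsetP => u.
rewrite !inE => lt; rewrite (iA e) // andbT.
by apply: contraTneq lt => ->; rewrite ltnn.
Qed.

Lemma initial_before e : initial (before e).
Proof. by move=> u v; rewrite !inE => h /ltn_trans; apply. Qed.

Lemma greedy_initial A : initial A -> \sum_(e in A) greedy e = a A.
Proof.
have [n] := ubnP #|A|; elim: n A => // n IHn A cA iA.
have [->|/last_elt[e eA sub]] := eqVneq A set0; first by rewrite big_set0.
have eB := initial_last iA eA sub.
rewrite (big_setD1 e) //= IHn; last 2 first.
- by move: cA; rewrite (cardsD1 e) eA.
- by rewrite eB; apply: initial_before.
by rewrite /greedy -eB setD1K // subrK.
Qed.

Hypothesis a_sub : forall A B, a (A :|: B) + a (A :&: B) <= a A + a B.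

Lemma last_elt_step A e : e \in A -> A :\ e \subset before e ->
  A :|: before e = e |: before e /\ A :&: before e = A :\ e.
Proof.
move=> eA /subsetP sub; split; apply/setP => u; rewrite !inE.
  have [->|ne] := eqVneq u e; first by rewrite eA.
  by case uA: (u \in A) => //=; have := sub u; rewrite !inE ne uA => /(_ isT)->.
have [->|ne] := eqVneq u e; first by rewrite ltnn andbF.
by case uA: (u \in A) => //=; have := sub u; rewrite !inE ne uA => /(_ isT)->.
Qed.

(** Let [e] be the last element of [A]. Submodularity for [A] and [before e] bounds the marginal
    value at [e] by [a A - a (A :\ e)], and induction bounds the rest. *)
Lemma greedy_le A : \sum_(e in A) greedy e <= a A.
Proof.
have [n] := ubnP #|A|; elim: n A => // n IHn A cA.
have [->|/last_elt[e eA sub]] := eqVneq A set0; first by rewrite big_set0 a0.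
rewrite (big_setD1 e) //=.
have := a_sub A (before e); have [-> ->] := last_elt_step eA sub.
have : \sum_(u in A :\ e) greedy u <= a (A :\ e).
  by apply: IHn; move: cA; rewrite (cardsD1 e) eA.
by rewrite /greedy; lra.
Qed.

Hypothesis a_strict : forall A B, incomparable A B ->
  a (A :|: B) + a (A :&: B) < a A + a B.

(** As [A] is not an initial segment, it is incomparable to [before v] for its last element [v], and
    the first step of [greedy_le] becomes strict. *)
Lemma greedy_lt A e u : e \in A -> u \notin A -> (rho u < rho e)%N ->
  \sum_(e in A) greedy e < a A.
Proof.
move=> eA uA lt.
have /last_elt[v vA sub] : A != set0 by apply/set0Pn; exists e.
rewrite (big_setD1 v) //=.
have := greedy_le (A :\ v).
have := @a_strict A (before v); have [-> ->] := last_elt_step vA sub.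
suff -> : incomparable A (before v) by move=> /(_ isT); rewrite /greedy; lra.
apply/andP; split; first by apply/subsetPn; exists v; rewrite // inE ltnn.
apply/subsetPn; exists u; rewrite // inE; apply: leq_trans lt _.
have [->//|ne] := eqVneq e v.
by have /(subsetP sub) : e \in A :\ v; rewrite inE ?inE ?ne // => /ltnW.
Qed.

End Greedy.

Section Modular.
Variables (E : finType) (M : matroid E) (d : nat).
Hypotheses (loopM : loopless M) (rkT : rk M setT = d.+1).
Variable (R : realFieldType).
Local Notation chain := (chain M).
Local Notation lk := (lk M).
Implicit Types (F G : {set E}) (S : {set {set E}}) (a : {set E} -> R).

(* In the order given by [refine S G] every member of [S] is an initial segment,
   and within a gap of [S] the elements outside [G] precede those of [G], so that
   [G] is not an initial segment. *)
Definition weight S G (e : E) := (#|[set F in S | e \notin F]| * 2 + (e \in G))%N.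
Definition refine S G (e : E) := (weight S G e * #|E| + enum_rank e)%N.

Lemma refine_inj S G : injective (refine S G).
Proof.
move=> e u h; apply: enum_rank_inj; apply: val_inj.
have := congr1 (modn^~ #|E|) h; rewrite /refine !modnMDl !modn_small //; exact: ltn_ord.
Qed.

Lemma refine_lt S G e u : (weight S G e < weight S G u)%N -> (refine S G e < refine S G u)%N.
Proof.
move=> lt; rewrite /refine; apply: leq_trans (_ : _ < (weight S G e).+1 * #|E|)%N _.
  by rewrite mulSn addnC ltn_add2r ltn_ord.
by apply: leq_trans (leq_mul lt (leqnn _)) (leq_addr _ _).
Qed.

Lemma refine_initial S G F : chain S -> F \in S -> initial (refine S G) F.
Proof.
move=> /chainP[_ cS] FS e u eF; apply: contraTT => uF; rewrite -leqNgt ltnW //.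
apply: refine_lt; rewrite /weight.
apply: leq_trans (_ : _ < #|[set F in S | e \notin F]|.+1 * 2)%N _.
  by rewrite mulSn addnC ltn_add2r; case: (_ \in _).
apply: leq_trans (leq_addr _ _); rewrite leq_mul2r /=; apply: proper_card.
apply/properP; split.
  apply/subsetP => K; rewrite !inE => /andP[KS eK]; rewrite KS /=.
  have /orP[KF|FK] := cS _ _ KS FS; first by apply: contra uF => /(subsetP KF).
  by move: eK; rewrite (subsetP FK).
by exists F; rewrite !inE FS ?uF ?eF.
Qed.

Lemma chain_modular S a : chain S -> a set0 = 0 -> a setT = 0 ->
  exists m : E -> R, \sum_e m e = 0 /\ {in S, forall F, \sum_(e in F) m e = a F}.
Proof.
(* With [set0] in place of [G] the order only has to refine [S]. *)
move=> cS a0 aT; exists (greedy (refine S set0) a).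
have inj := @refine_inj S set0.
split; last by move=> F FS; apply: greedy_initial => //; apply: refine_initial.
by rewrite -[RHS]aT -(greedy_initial inj a0) //; apply: eq_bigl => e; rewrite inE.
Qed.

Lemma lk_modular S a G : chain S -> G \in lk S -> a set0 = 0 -> a setT = 0 ->
  (forall A B, a (A :|: B) + a (A :&: B) <= a A + a B) ->
  (forall A B, incomparable A B -> a (A :|: B) + a (A :&: B) < a A + a B) ->
  exists m : E -> R, [/\ \sum_e m e = 0, {in S, forall F, \sum_(e in F) m e = a F},
    forall F, \sum_(e in F) m e <= a F & \sum_(e in G) m e < a G].
Proof.
move=> cS GS a0 aT ale alt; exists (greedy (refine S G) a).
have inj := @refine_inj S G; split.
- by rewrite -[RHS]aT -(greedy_initial inj a0) //; apply: eq_bigl => e; rewrite inE.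
- by move=> F FS; apply: greedy_initial => //; apply: refine_initial.
- by move=> F; apply: greedy_le.
have [L [U [[LS US _ adj] LG GU]]] := lk_gap loopM rkT cS GS.
have /properP[_ [e eG eL]] := LG; have /properP[_ [u uU uG]] := GU.
apply: (@greedy_lt _ _ _ _ inj a0 ale alt _ e u) => //.
(* Both [e] and [u] are in the gap, so they lie in the same members of [S]; only membership in [G]
   separates their weights, and it puts [u] first. *)
apply: refine_lt; rewrite /weight eG (negPf uG) addn0 addn1 ltnS.
rewrite leq_mul2r /=; apply: eq_leq; congr #|pred_of_set _|.
apply/setP => F; rewrite !inE; case FS: (F \in S) => //=.
have /orP[FL|UF] := adj F (in_extS FS).
  rewrite (contra (subsetP FL e) eL).
  by rewrite (contra (subsetP (subset_trans FL (proper_sub LG)) u) uG).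
by rewrite (subsetP UF u) // (subsetP UF e) // (subsetP (proper_sub GU)).
Qed.

(** For each flat of the link some modular function is strict there and at most [a] everywhere.
    Successive midpoints keep the equalities on [S] and collect the strict inequalities. *)
Lemma strict_modular S a : chain S -> a set0 = 0 -> a setT = 0 ->
  (forall A B, a (A :|: B) + a (A :&: B) <= a A + a B) ->
  (forall A B, incomparable A B -> a (A :|: B) + a (A :&: B) < a A + a B) ->
  exists m : E -> R, [/\ \sum_e m e = 0, {in S, forall F, \sum_(e in F) m e = a F} &
    {in lk S, forall F, \sum_(e in F) m e < a F}].
Proof.
move=> cS a0 aT ale alt.
suff [m [m0 mS mle mlt]] : exists m : E -> R, [/\ \sum_e m e = 0,
    {in S, forall F, \sum_(e in F) m e = a F},
    forall F, F \in lk S -> \sum_(e in F) m e <= a F &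
    forall F, F \in enum (lk S) -> \sum_(e in F) m e < a F].
  by exists m; split=> // F FS; apply: mlt; rewrite mem_enum.
have : {subset enum (lk S) <= lk S} by move=> F; rewrite mem_enum.
elim: (enum (lk S)) => [_|G s IHs sub].
  have [->|[G GS]] := set_0Vmem (lk S).
    have [m [m0 mS]] := chain_modular cS a0 aT.
    by exists m; split=> // F; rewrite inE.
  have [m [m0 mS mle _]] := lk_modular cS GS a0 aT ale alt.
  by exists m; split.
have [|m [m0 mS mle mlt]] := IHs; first by move=> F Fs; apply: sub; rewrite inE Fs orbT.
have [|m' [m0' mS' mle' mlt']] := lk_modular cS (G := G) _ a0 aT ale alt.
  by apply: sub; rewrite inE eqxx.
have E2 (P : pred E) : \sum_(e | P e) (m e + m' e) / 2 =
    (\sum_(e | P e) m e + \sum_(e | P e) m' e) / 2.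
  by rewrite -mulr_suml big_split.
exists (fun e => (m e + m' e) / 2); split.
- by rewrite E2 m0 m0'; lra.
- by move=> F FS; rewrite E2 mS ?mS' //; lra.
- by move=> F FS; rewrite E2; have := mle F FS; have := mle' F; lra.
move=> F; rewrite inE => /orP[/eqP->|Fs]; rewrite E2.
  by have := mle G (sub _ (mem_head _ _)); lra.
by have := mlt F Fs; have := mle' F; lra.
Qed.

End Modular.

(** * Symmetric matrices with one positive eigenvalue *)

Section Spectral.

Lemma Re_real_complexM (R : rcfType) (z : R[i]) (x : R) :
  complex.Re (z * real_complex R x) = complex.Re z * x.
Proof. by case: z => a b /=; rewrite mulr0 subr0. Qed.

Lemma Im_real_complexM (R : rcfType) (z : R[i]) (x : R) :
  complex.Im (z * real_complex R x) = complex.Im z * x.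
Proof. by case: z => a b /=; rewrite mulr0 add0r. Qed.

Lemma Re_sum (R : rcfType) (I : finType) (F : I -> R[i]) :
  complex.Re (\sum_i F i) = \sum_i complex.Re (F i).
Proof. by apply: (big_morph _ _ (erefl : complex.Re 0 = 0 :> R)) => -[? ?] [? ?]. Qed.

Lemma Im_sum (R : rcfType) (I : finType) (F : I -> R[i]) :
  complex.Im (\sum_i F i) = \sum_i complex.Im (F i).
Proof. by apply: (big_morph _ _ (erefl : complex.Im 0 = 0 :> R)) => -[? ?] [? ?]. Qed.

(* [a j] and [b j] are the real and imaginary parts of an orthonormal
   eigenbasis over R[i]; some of them may vanish. *)
Lemma symmetric_spectral (R : rcfType) n (N : 'M[R]_n) : N^T = N ->
  exists (l : 'I_n -> R) (a b : 'I_n -> 'I_n -> R),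
  [/\ forall j i, \sum_k a j k * N k i = l j * a j i,
      forall j i, \sum_k b j k * N k i = l j * b j i &
      forall h : 'I_n -> R, \sum_i \sum_k h i * N i k * h k =
        \sum_j l j * ((\sum_i h i * a j i) ^+ 2 + (\sum_i h i * b j i) ^+ 2)].
Proof.
move=> Nsym; pose C : numClosedFieldType := R[i].
pose rc := real_complex R; pose NC : 'M[C]_n := map_mx rc N.
have NCherm : NC \is hermsymmx.
  apply: realsym_hermsym.
    apply/is_hermitianmxP; rewrite expr0 scale1r map_mx_id // /NC map_trmx.
    by rewrite Nsym.
  by apply/mxOverP => i j; rewrite mxE complex_real.
have Dreal := hermitian_spectral_diag_real NCherm.
have /orthomx_spectralP eN := hermitian_normalmx NCherm.
set P := spectralmx NC in eN; set D := spectral_diag NC in eN Dreal.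
have Pu : P \in unitmx := spectral_unit NC.
have iP : invmx P = map_mx Num.conj P^T.
  by rewrite invmx_unitary // spectral_unitarymx.
have PN : P *m NC = diag_mx D *m P by rewrite {1}eN !mulmxA mulmxV // mul1mx.
pose l j := complex.Re (D 0 j).
have lE j : D 0 j = rc (l j).
  by rewrite /rc /l RRe_real //; apply: (mxOverP Dreal).
pose a j i := complex.Re (P j i); pose b j i := complex.Im (P j i).
have eig j i : \sum_k P j k * rc (N k i) = P j i * rc (l j).
  have := congr1 (fun A : 'M[C]_n => A j i) PN.
  rewrite !mxE => e; transitivity (\sum_k P j k * NC k i).
    by apply: eq_bigr => k _; rewrite !mxE.
  rewrite e (bigD1 j) //= big1 ?addr0 => [|k nkj].
    by rewrite !mxE eqxx mulr1n lE mulrC.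
  by rewrite !mxE eq_sym (negPf nkj) mulr0n mul0r.
exists l, a, b; split.
- move=> j i; have := congr1 (@complex.Re R) (eig j i).
  rewrite Re_real_complexM Re_sum mulrC => <-.
  by apply: eq_bigr => k _; rewrite Re_real_complexM.
- move=> j i; have := congr1 (@complex.Im R) (eig j i).
  rewrite Im_real_complexM Im_sum mulrC => <-.
  by apply: eq_bigr => k _; rewrite Im_real_complexM.
move=> h; apply: (@complexI R).
have NE i k : rc (N i k) = \sum_j Num.conj (P j i) * rc (l j) * P j k.
  transitivity (NC i k); first by rewrite !mxE.
  rewrite eN iP -mulmxA mxE; apply: eq_bigr => j _.
  rewrite -[RHS]mulrA mxE mxE; congr (_ * _); rewrite mxE (bigD1 j) //= big1.
    by rewrite addr0 !mxE eqxx mulr1n lE.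
  by move=> k' nk; rewrite !mxE eq_sym (negPf nk) mulr0n mul0r.
have rcsum (I : finType) (F : I -> R) : rc (\sum_i F i) = \sum_i rc (F i) by apply: raddf_sum.
have rcM x y : rc (x * y) = rc x * rc y by apply: rmorphM.
rewrite -/rc !rcsum.
transitivity (\sum_i \sum_k \sum_j rc (h i) * (Num.conj (P j i) * rc (l j) * P j k) * rc (h k)).
  apply: eq_bigr => i _; rewrite rcsum; apply: eq_bigr => k _.
  by rewrite !rcM NE mulr_sumr mulr_suml.
transitivity (\sum_j rc (l j) * ((\sum_i rc (h i) * Num.conj (P j i)) * (\sum_k P j k * rc (h k)))).
  rewrite exchange_big /=; under eq_bigr => k _ do rewrite exchange_big /=.
  rewrite exchange_big /=; apply: eq_bigr => j _.
  rewrite mulr_suml mulr_sumr exchange_big /=; apply: eq_bigr => i _.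
  rewrite !mulr_sumr; apply: eq_bigr => k _.
  ring.
apply: eq_bigr => j _; rewrite -/rc rcM; congr (_ * _).
have -> : \sum_k P j k * rc (h k) = Complex (\sum_i h i * a j i) (\sum_i h i * b j i).
  apply/eqP; rewrite eq_complex Re_sum Im_sum /=; apply/andP; split; apply/eqP.
    by apply: eq_bigr => k _; rewrite Re_real_complexM mulrC.
  by apply: eq_bigr => k _; rewrite Im_real_complexM mulrC.
have -> : \sum_k rc (h k) * Num.conj (P j k) = Complex (\sum_i h i * a j i) (- \sum_i h i * b j i).
  apply/eqP; rewrite eq_complex Re_sum Im_sum /=; apply/andP; split; apply/eqP.
    apply: eq_bigr => k _; rewrite mulrC Re_real_complexM mulrC /a; congr (_ * _).
    by case: (P j k).
  rewrite -sumrN; apply: eq_bigr => k _; rewrite mulrC Im_real_complexM mulrC /b -mulrN.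
  by congr (_ * _); case: (P j k).
set u := \sum_i _ * a j i; set v := \sum_i _ * b j i.
by apply/eqP; rewrite eq_complex /=; apply/andP; split; apply/eqP; ring.
Qed.
End Spectral.

Section OnePositive.
Variables (R : rcfType) (n : nat) (M : 'I_n -> 'I_n -> R) (c : 'I_n -> R).
Hypotheses (Msym : forall i j, M i j = M j i) (c_gt0 : forall i, 0 < c i)
  (M_ge0 : forall i j, i != j -> 0 <= M i j).
Let v i := \sum_j M i j * c j.
Hypotheses (v_gt0 : forall i, 0 < v i)
  (quad_le : forall x : 'I_n -> R,
     \sum_i \sum_j x i * M i j * x j <= \sum_i c i / v i * (\sum_j M i j * x j) ^+ 2)
  (conn : forall f : 'I_n -> R, (forall i j, i != j -> 0 < M i j -> f i = f j) ->
     forall i j, f i = f j).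

(** The Laplacian of the graph with edge weights [M i j * c i * c j]. Its nonnegativity bounds the
    form of [M] by the norm with weights [v i / c i]. *)
Lemma dirichlet_form (x : 'I_n -> R) :
  \sum_i \sum_j M i j * c i * c j * (x i / c i - x j / c j) ^+ 2 =
  2 * (\sum_i x i ^+ 2 * v i / c i - \sum_i \sum_j x i * M i j * x j).
Proof.
have cn i : c i != 0 by rewrite gt_eqF.
transitivity (\sum_i \sum_j (x i ^+ 2 * (M i j * c j) / c i +
   (x j ^+ 2 * (M j i * c i) / c j - 2 * (x i * M i j * x j)))).
  apply: eq_bigr => i _; apply: eq_bigr => j _; rewrite (Msym j i).
  by field; rewrite !cn.
have s1 : \sum_i x i ^+ 2 * v i / c i = \sum_i \sum_j x i ^+ 2 * (M i j * c j) / c i.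
  by apply: eq_bigr => i _; rewrite /v mulr_sumr mulr_suml.
under eq_bigr => i _ do rewrite big_split /= big_split /= sumrN -mulr_sumr.
rewrite big_split /= big_split /= sumrN -mulr_sumr.
rewrite [X in _ + (X - _)]exchange_big /= -s1; ring.
Qed.

(** For an eigenvector of weighted norm [s], [quad_le] gives [s <= l * s], while nonnegativity of
    the Dirichlet form gives the reverse. So the Dirichlet form vanishes and [x i / c i] is constant
    along edges. *)
Lemma eigenvector_prop (x : 'I_n -> R) (l : R) : 0 < l ->
  (forall i, \sum_j M i j * x j = l * (x i * v i / c i)) ->
  exists k, forall i, x i = k * c i.
Proof.
move=> l0 eig.
have cn i : c i != 0 by rewrite gt_eqF.
have vn i : v i != 0 by rewrite gt_eqF.
pose s := \sum_i x i ^+ 2 * v i / c i.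
have s0 : 0 <= s.
  apply: sumr_ge0 => i _; apply: divr_ge0; last exact/ltW/c_gt0.
  by apply: mulr_ge0; [exact: sqr_ge0|exact/ltW/v_gt0].
have e1 : \sum_i \sum_j x i * M i j * x j = l * s.
  rewrite mulr_sumr; apply: eq_bigr => i _.
  under eq_bigr => j _ do rewrite -mulrA.
  by rewrite -mulr_sumr eig; ring.
have e2 : \sum_i c i / v i * (\sum_j M i j * x j) ^+ 2 = l ^+ 2 * s.
  rewrite mulr_sumr; apply: eq_bigr => i _; rewrite eig.
  by field; rewrite cn vn.
have le := quad_le x; rewrite e1 e2 in le.
have ls : s <= l * s by rewrite -(ler_pM2l l0) mulrA -expr2.
have dir := dirichlet_form x; rewrite -/s e1 in dir.
have term_ge0 i j : 0 <= M i j * c i * c j * (x i / c i - x j / c j) ^+ 2.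
  have [->|nij] := eqVneq i j; first by rewrite subrr expr0n mulr0.
  apply: mulr_ge0 (sqr_ge0 _); apply: mulr_ge0 (ltW (c_gt0 j)).
  by apply: mulr_ge0 (ltW (c_gt0 i)); apply: M_ge0.
have dir0 : \sum_i \sum_j M i j * c i * c j * (x i / c i - x j / c j) ^+ 2 = 0.
  apply/eqP; rewrite eq_le; apply/andP; split; first by rewrite dir; lra.
  by apply: sumr_ge0 => i _; apply: sumr_ge0 => j _.
have h : forall i j, i != j -> 0 < M i j -> x i / c i = x j / c j.
  move=> i j _ Mij; apply/eqP; rewrite -subr_eq0.
  have /psumr_eq0P/(_ i isT) : \sum_i \sum_j M i j * c i * c j * (x i / c i - x j / c j) ^+ 2 = 0 by [].
  move=> /(_ (fun i _ => sumr_ge0 _ (fun j _ => term_ge0 i j))).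
  move/psumr_eq0P => /(_ (fun j _ => term_ge0 i j)) /(_ j isT) /eqP.
  rewrite mulf_eq0 expf_eq0 /= => /orP[|->//].
  by rewrite !mulf_eq0 !(negPf (cn _)) (gt_eqF Mij).
have {}h := conn h.
have [i _|no] := pickP (fun _ : 'I_n => true).
  by exists (x i / c i) => j; rewrite (h i j) divfK.
by exists 0 => i; have := no i.
Qed.

(* The eigenvalues of M relative to the weights v / c are <= 0 or >= 1 by
   [quad_le], and <= 1 by nonnegativity off the diagonal; by connectedness the
   eigenvalue 1 is simple, with eigenvector c. *)
Lemma one_positive (x : 'I_n -> R) : \sum_i x i * v i = 0 ->
  \sum_i \sum_j x i * M i j * x j <= 0.
Proof.
move=> x0; pose s i := Num.sqrt (c i / v i).
have cn i : c i != 0 by rewrite gt_eqF.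
have vn i : v i != 0 by rewrite gt_eqF.
have cv i : 0 < c i / v i by rewrite divr_gt0.
have sn i : s i != 0 by rewrite gt_eqF // sqrtr_gt0.
have s2 i : s i * s i = c i / v i by rewrite -expr2 sqr_sqrtr // ltW.
(* Rescaling by [s] turns the eigenvalue problem relative to the weights [v i / c i] into an
   ordinary symmetric one. *)
pose N : 'M[R]_n := \matrix_(i, j) (s i * M i j * s j).
have [|l [a [b [Ha Hb Hab]]]] := @symmetric_spectral R n N.
  by apply/matrixP => i j; rewrite !mxE Msym; ring.
have -> : \sum_i \sum_j x i * M i j * x j =
    \sum_i \sum_j (x i / s i) * N i j * (x j / s j).
  by apply: eq_bigr => i _; apply: eq_bigr => j _; rewrite mxE; field; rewrite !sn.
rewrite Hab; apply: sumr_le0 => j _.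
have [lj|lj] := lerP (l j) 0.
  by rewrite mulr_le0_ge0 // addr_ge0 // sqr_ge0.
(* After rescaling, an eigenvector of positive eigenvalue is a multiple of [c], to which [x] is
   orthogonal for the weights [v i / c i]. *)
suff orth y : (forall i, \sum_k y k * N k i = l j * y i) -> \sum_i x i / s i * y i = 0.
  by rewrite !orth // expr0n addr0 mulr0.
move=> eig; have [|k hk] := @eigenvector_prop (fun i => s i * y i) (l j) lj.
  move=> i; apply: (mulfI (sn i)).
  transitivity (\sum_k y k * N k i).
    by rewrite mulr_sumr; apply: eq_bigr => k _; rewrite mxE (Msym k i); ring.
  rewrite eig; transitivity (l j * (s i * s i * (v i / c i) * y i)); last by ring.
  by rewrite s2; field; rewrite cn vn.
transitivity (k * \sum_i x i * v i); last by rewrite x0 mulr0.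
rewrite mulr_sumr; apply: eq_bigr => i _.
transitivity (x i * (s i * y i) / (s i * s i)); first by field.
by rewrite hk s2; field; rewrite cn vn.
Qed.

End OnePositive.

(** The row space of a symmetric matrix is the orthogonal complement of its kernel, and the columns
    of [cokermx Q] span that kernel. *)
Lemma symmetric_solve (F : fieldType) n (Q : 'M[F]_n) (b : 'rV[F]_n) : Q^T = Q ->
  (forall x : 'rV[F]_n, x *m Q = 0 -> b *m x^T = 0) -> exists z, z *m Q = b.
Proof.
move=> Qs h; suff /submxP[z ->] : (b <= Q)%MS by exists z.
rewrite submxE; apply/eqP/rowP => j.
have /h : row j (cokermx Q)^T *m Q = 0.
  by rewrite -row_mul -[in X in _ *m X]Qs -trmx_mul mulmx_coker trmx0 row0.
move/matrixP/(_ 0 0); rewrite !mxE => e; rewrite -[RHS]e.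
by apply: eq_bigr => i _; rewrite !mxE.
Qed.

(** * Degree computations on chains *)

Section Chow.
(* [A] stands for the Chow ring, [iota] for its scalars, [x F] for the class of
   [F], and [D] for the degree map extended by zero to the other degrees. *)
Variables (E : finType) (M : matroid E) (d : nat) (R : rcfType) (A : comNzRingType).
Variables (iota : {rmorphism R -> A}) (x : {set E} -> A) (D : A -> R).
Local Notation r := (rk M).
Local Notation flat := (is_flat M).
Local Notation pfl := (is_pflat M).
Local Notation chain := (chain M).
Local Notation lk := (lk M).
Implicit Types (F G H K L U : {set E}) (S T : {set {set E}}) (e : E).
Implicit Types (a c : {set E} -> R).

Hypotheses (loopM : loopless M) (rkT : r setT = d.+1).
Hypothesis x_inc : forall F G, pfl F -> pfl G -> incomparable F G -> x F * x G = 0.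
Hypothesis x_lin : forall i j : E,
  \sum_(F | pfl F && (i \in F)) x F = \sum_(F | pfl F && (j \in F)) x F.
Hypothesis D_lin : forall k u v, D (iota k * u + v) = k * D u + D v.
Hypothesis D_chain : forall S, chain S -> #|S| = d -> D (\prod_(F in S) x F) = 1.
(* A convention, so that the ends of a saturated chain need no special case. *)
Hypotheses (x0 : x set0 = 1) (xT : x setT = 1).

Lemma DD u v : D (u + v) = D u + D v.
Proof. by have := D_lin 1 u v; rewrite rmorph1 !mul1r. Qed.

Lemma D0 : D 0 = 0.
Proof. by apply: (@addIr _ (D 0)); rewrite -DD !add0r. Qed.

Lemma DZ k u : D (iota k * u) = k * D u.
Proof. by have := D_lin k u 0; rewrite D0 !addr0. Qed.

Lemma DN u : D (- u) = - D u.
Proof. by apply/eqP; rewrite -addr_eq0 -DD addNr D0. Qed.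

Lemma Dsum (I : Type) (s : seq I) (P : pred I) (f : I -> A) :
  D (\sum_(i <- s | P i) f i) = \sum_(i <- s | P i) D (f i).
Proof. exact: (big_morph D DD D0). Qed.

Definition lin c : A := \sum_(F | pfl F) iota (c F) * x F.
Definition xs S : A := \prod_(F in S) x F.
Definition msum (m : E -> R) F : R := \sum_(e in F) m e.

Lemma lin_ext c c' : (forall F, pfl F -> c F = c' F) -> lin c = lin c'.
Proof. by move=> h; apply: eq_bigr => F pF; rewrite h. Qed.

Lemma linD c c' : lin (fun F => c F + c' F) = lin c + lin c'.
Proof.
by rewrite -big_split; apply: eq_bigr => F _; rewrite rmorphD mulrDl.
Qed.

Lemma linZ k c : lin (fun F => k * c F) = iota k * lin c.
Proof. by rewrite mulr_sumr; apply: eq_bigr => F _; rewrite rmorphM mulrA. Qed.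

Lemma linB c c' : lin (fun F => c F - c' F) = lin c - lin c'.
Proof.
by rewrite -sumrB; apply: eq_bigr => F _; rewrite rmorphB mulrBl.
Qed.

Lemma lin_delta F : pfl F -> lin (fun G => (G == F)%:R) = x F.
Proof.
move=> pF; rewrite /lin (bigD1 F) //= eqxx rmorph1 mul1r big1 ?addr0 // => G /andP[_ nG].
by rewrite (negPf nG) rmorph0 mul0r.
Qed.

(** Grouped by elements, each [e] contributes [m e] times the sum of [x F] over the flats containing
    [e], and this sum does not depend on [e]. *)
Lemma lin_msum m : \sum_e m e = 0 -> lin (msum m) = 0.
Proof.
move=> m0; have [e0 _|no] := pickP (fun _ : E => true); last first.
  by apply: big1 => F _; rewrite /msum big1 ?rmorph0 ?mul0r // => e; have := no e.
transitivity (\sum_e iota (m e) * \sum_(F | pfl F && (e \in F)) x F); last first.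
  under eq_bigr => e _ do rewrite (x_lin e e0).
  by rewrite -mulr_suml -rmorph_sum m0 rmorph0 mul0r.
under [RHS]eq_bigr => e _ do rewrite mulr_sumr.
rewrite (exchange_big_dep pfl) /=; last by move=> e F _ /andP[].
apply: eq_bigr => F pF; rewrite rmorph_sum mulr_suml.
by apply: eq_bigl => e; rewrite pF.
Qed.

Lemma lin_mod c m : \sum_e m e = 0 -> lin (fun F => c F - msum m F) = lin c.
Proof. by move=> m0; rewrite linB lin_msum // subr0. Qed.

Lemma xsU1 S F : F \notin S -> xs (F |: S) = x F * xs S.
Proof. by move=> FS; rewrite /xs big_setU1. Qed.

Lemma xs0 : xs set0 = 1.
Proof. by rewrite /xs big_set0. Qed.

Lemma xs_nlk S F : chain S -> pfl F -> F \notin S -> F \notin lk S -> xs S * x F = 0.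
Proof.
move=> /chainP[cS _] pF FS nF.
have /forall_inPn[G GS nG] : ~~ [forall G in S, cmp G F].
  by move: nF; rewrite inE pF FS.
rewrite /xs (big_setD1 G) //= -mulrA mulrCA [x G * _]x_inc ?mulr0 ?cmpNinc //.
exact: cS.
Qed.

(** Coefficients vanishing on [S] avoid repeated factors, and flats outside the link give zero by
    incomparability. *)
Lemma xs_lin S c : chain S -> {in S, forall F, c F = 0} ->
  xs S * lin c = \sum_(F in lk S) iota (c F) * xs (F |: S).
Proof.
move=> cS c0; rewrite /lin mulr_sumr [RHS]big_mkcond [LHS]big_mkcond /=.
apply: eq_bigr => F _; case: ifP => [pF|npF]; case: ifP => [FS|FS].
- by have [_ nF _] := lkP _ _ _ FS; rewrite xsU1 // mulrCA [xs S * _]mulrC.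
- have [FinS|FnS] := boolP (F \in S); first by rewrite c0 // rmorph0 mul0r mulr0.
  by rewrite mulrCA xs_nlk ?mulr0 // FS.
- by have [pF _ _] := lkP _ _ _ FS; rewrite pF in npF.
- by [].
Qed.

Lemma lin_vanishing S c : chain S -> exists c', lin c' = lin c /\ {in S, forall F, c' F = 0}.
Proof.
(* Values off the proper flats do not affect [lin]; they are set to zero because [chain_modular]
   asks for this at [set0] and [setT]. *)
move=> cS; pose c1 F := if pfl F then c F else 0.
have [| |m [m0 mS]] := @chain_modular E M R S c1 cS.
- by rewrite /c1 /is_pflat eqxx andbF.
- by rewrite /c1 /is_pflat eqxx !andbF.
exists (fun F => c1 F - msum m F); split.
  by rewrite lin_mod //; apply: lin_ext => F pF; rewrite /c1 pF.
by move=> F FS; rewrite /msum mS // subrr.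
Qed.

(** * Positivity of ample classes and self-intersections *)

Variables (a : {set E} -> R).
Hypotheses (a0 : a set0 = 0) (aT : a setT = 0)
  (a_sub : forall F G, a (F :|: G) + a (F :&: G) <= a F + a G)
  (a_lt : forall F G, incomparable F G -> a (F :|: G) + a (F :&: G) < a F + a G).
Local Notation l := (lin a).

Lemma ample_at S : chain S -> exists c,
  [/\ lin c = l, {in S, forall F, c F = 0} & {in lk S, forall F, 0 < c F}].
Proof.
move=> cS; have [m [m0 mS mlk]] := strict_modular loopM rkT cS a0 aT a_sub a_lt.
exists (fun F => a F - msum m F); split; first exact: lin_mod.
  by move=> F FS; rewrite /msum mS // subrr.
by move=> F FS; rewrite subr_gt0 mlk.
Qed.

Lemma D_pos k S : chain S -> (#|S| + k = d)%N -> 0 < D (xs S * l ^+ k).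
Proof.
elim: k S => [|k IHk] S cS cardS.
  by rewrite expr0 mulr1 D_chain ?ltr01 // -cardS addn0.
have [c [el cS0 clk]] := ample_at cS.
rewrite exprS mulrA -{1}el xs_lin // mulr_suml Dsum.
have pos F : F \in lk S -> 0 < D (iota (c F) * xs (F |: S) * l ^+ k).
  move=> FS; rewrite -mulrA DZ; apply: mulr_gt0; first exact: clk.
  by apply: IHk (chainU1 cS FS) _; rewrite (card_lkU1 FS) addSn -addnS.
have [|G GS] := lk_ex loopM rkT cS; first by rewrite -cardS addnS ltnS leq_addr.
rewrite (bigD1 G) //=; apply: ltr_pwDl; first exact: pos.
by apply: sumr_ge0 => F /andP[FS _]; apply/ltW/pos.
Qed.

Lemma D_gt0 k S F G : chain S -> F \in lk S -> G \in lk S -> F != G -> cmp F G ->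
  (#|S|.+2 + k = d)%N -> 0 < D (xs S * x F * x G * l ^+ k).
Proof.
move=> cS FS GS nFG FG cardS; have [pF nF _] := lkP _ _ _ FS.
rewrite [xs S * x F]mulrC -xsU1 // [xs _ * x G]mulrC.
have GS' : G \in lk (F |: S) by apply: in_lk_setU1; rewrite // eq_sym.
rewrite -xsU1; last by case/lkP: GS'.
apply: D_pos; first exact: chainU1 (chainU1 cS FS) GS'.
by rewrite (card_lkU1 GS') (card_lkU1 FS).
Qed.

Lemma D_ge0 k S F G : chain S -> F \in lk S -> G \in lk S -> F != G ->
  (#|S|.+2 + k = d)%N -> 0 <= D (xs S * x F * x G * l ^+ k).
Proof.
move=> cS FS GS nFG cardS; have [pF nF _] := lkP _ _ _ FS; have [pG _ _] := lkP _ _ _ GS.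
have [FG|nc] := boolP (cmp F G); first exact/ltW/D_gt0.
by rewrite -[xs S * _ * _]mulrA x_inc ?cmpNinc // mulr0 mul0r D0.
Qed.

Lemma sum_indicator (P : pred E) w : \sum_(e | P e) (e == w)%:R = (P w)%:R :> R.
Proof.
case Pw: (P w); first by rewrite (bigD1 w) //= eqxx big1 ?addr0 // => e /andP[_ /negPf->].
by rewrite big1 // => e Pe; case: eqVneq => // ew; rewrite ew Pw in Pe.
Qed.

Lemma D_xs_lin_at T c G : chain T -> G \in T -> {in T, forall F, F != G -> c F = 0} ->
  D (xs T * lin c) = c G * D (xs T * x G) + \sum_(F in lk T) c F * D (xs (F |: T)).
Proof.
move=> cT GT c0; have [pT _] := chainP _ _ cT.
pose c' F := c F - c G * (F == G)%:R.
have -> : lin c = lin c' + iota (c G) * x G.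
  by rewrite /c' linB linZ lin_delta ?subrK ?pT.
rewrite mulrDr DD addrC mulrCA DZ xs_lin //; last first.
  move=> F FT; rewrite /c'; have [->|nFG] := eqVneq; first by rewrite mulr1 subrr.
  by rewrite mulr0 subr0 c0.
congr (_ + _); rewrite Dsum; apply: eq_bigr => F FT; rewrite DZ /c'.
have [eFG|_] := eqVneq F G; last by rewrite mulr0 subr0.
by have [_] := lkP _ _ _ FT; rewrite eFG GT.
Qed.

(** In the gap around [G], the relation of [e] in [G :\: L] and [u] in [U :\: G] has coefficient 1
    at [G], 0 at the other members of [T], and nonnegative coefficients on the link. It expresses
    the degree as minus a sum of nonnegative terms. *)
Lemma D_diag T G : chain T -> #|T|.+1 = d -> G \in T -> D (xs T * x G) <= 0.
Proof.
move=> cT cardT GT; have [pT _] := chainP _ _ cT.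
have cTG : chain (T :\ G) by apply: chainS cT; apply: subD1set.
have [L [U [[_ _ _ adj] LG GU]]] := lk_gap loopM rkT cTG (lk_of_chain cT GT).
have /properP[_ [e eG eL]] := LG; have /properP[_ [u uU uG]] := GU.
pose m (w : E) : R := (w == e)%:R - (w == u)%:R.
have mE F : msum m F = (e \in F)%:R - (u \in F)%:R.
  by rewrite /msum sumrB !sum_indicator.
have m0 : \sum_w m w = 0 by rewrite sumrB !sum_indicator subrr.
have := @D_xs_lin_at T (msum m) G cT GT; rewrite lin_msum // mulr0 D0 !mE eG (negPf uG) subr0 mul1r.
move=> /(_ _)/esym h.
have -> : D (xs T * x G) = - \sum_(F in lk T) msum m F * D (xs (F |: T)).
  apply/eqP; rewrite -addr_eq0; apply/eqP/h => F FT nFG; rewrite mE.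
  have /adj/orP[FL|UF] : F \in ext (T :\ G) by apply: in_extS; rewrite !inE nFG.
    rewrite (negPf (contra (subsetP FL e) eL)).
    by rewrite (negPf (contra (subsetP (subset_trans FL (proper_sub LG)) u) uG)) subrr.
  by rewrite (subsetP UF u) // (subsetP UF e) ?subrr // (subsetP (proper_sub GU)).
rewrite oppr_le0; apply: sumr_ge0 => F FT; apply: mulr_ge0.
  have [_ _ hF] := lkP _ _ _ FT; rewrite mE.
  have /orP[GF|FG] := hF G GT; first by rewrite (subsetP GF) // subr_ge0 ler_nat leq_b1.
  by rewrite (negPf (contra (subsetP FG u) uG)) subr0 ler0n.
rewrite D_chain ?ler01 //; first exact: chainU1.
by rewrite (card_lkU1 FT).
Qed.


(** * Excess on an interval and the base case of the Hodge index inequality *)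

Definition restr c F : R := if pfl F then c F else 0.

Lemma restrE c F : pfl F -> restr c F = c F.
Proof. by rewrite /restr => ->. Qed.

Lemma restr0 c : restr c set0 = 0.
Proof. by rewrite /restr /is_pflat eqxx andbF. Qed.

Lemma restrT c : restr c setT = 0.
Proof. by rewrite /restr /is_pflat eqxx !andbF. Qed.

Lemma lin_restr c : lin (restr c) = lin c.
Proof. by apply: lin_ext => F /restrE. Qed.

(* When [L] and [U] bound the only gap of [S] and [r U = (r L).+2], this is the
   degree of [xs S * lin c], see [xs_corank1]. *)
Definition excess c L U : R :=
  \sum_(p in atoms M L U) (restr c p - restr c L) - (restr c U - restr c L).

Lemma excessB c c' k L U :
  excess (fun F => c F - k * c' F) L U = excess c L U - k * excess c' L U.
Proof.
have h F : restr (fun F => c F - k * c' F) F = restr c F - k * restr c' F.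
  by rewrite /restr; case: ifP => // _; rewrite mulr0 subr0.
rewrite /excess !h.
transitivity (\sum_(p in atoms M L U) ((restr c p - restr c L) - k * (restr c' p - restr c' L))
  - (restr c U - k * restr c' U - (restr c L - k * restr c' L))).
  by congr (_ - _); apply: eq_bigr => p _; rewrite !h; ring.
by rewrite sumrB -mulr_sumr; ring.
Qed.

(** A modular function makes the coefficients vanish on [ext S] and leaves the excess unchanged by
    [sum_atoms_sub]. *)
Lemma excess_sum S L U c : chain S -> adjacent S L U ->
  exists z, [/\ lin z = lin c, {in ext S, forall F, z F = 0} &
                \sum_(p in atoms M L U) z p = excess c L U].
Proof.
move=> cS [LS US LU _].
have fL := ext_flat loopM cS LS; have fU := ext_flat loopM cS US.
have [m0 [m0T m0S]] := chain_modular (E := E) cS (restr0 c) (restrT c).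
pose z F := restr c F - msum m0 F.
have z_ext F : F \in ext S -> z F = 0.
  rewrite /z /msum !inE => /or3P[/eqP->|/eqP->|FS].
  - by rewrite restr0 big_set0 subrr.
  - rewrite restrT (eq_bigl predT) ?m0T ?subrr // => e; by rewrite inE.
  - by rewrite m0S // subrr.
exists z; split=> //; first by rewrite lin_mod // lin_restr.
have e F : F \in ext S -> restr c F = msum m0 F.
  by move=> /z_ext/eqP; rewrite subr_eq0 => /eqP.
rewrite /excess (e U) // (e L) // /msum -(sum_atoms_sub m0 fL fU (proper_sub LU)) -sumrB.
by apply: eq_bigr => p _; rewrite /z /msum; ring.
Qed.

(** The values of [z] on the atoms come from a modular function: spread [z p] evenly over [p :\: L].
    Its total is the excess, so when this is zero it gives a relation, and it vanishes on [S]
    because its weight lies in the gap. *)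
Lemma clear_atoms S L U c : chain S -> adjacent S L U -> excess c L U = 0 ->
  exists c', [/\ lin c' = lin c, {in S, forall F, c' F = 0} &
                 {in atoms M L U, forall p, c' p = 0}].
Proof.
move=> cS adj ex0; have [LS US LU adjF] := adj.
have fL := ext_flat loopM cS LS; have fU := ext_flat loopM cS US.
have LsU := proper_sub LU.
have [z [zc z_ext zP]] := excess_sum c cS adj; rewrite ex0 in zP.
pose m1 e := if e \in U :\: L then
  z (mclosure M (e |: L)) / #|mclosure M (e |: L) :\: L|%:R else 0.
have m1p p : p \in atoms M L U -> \sum_(e in p :\: L) m1 e = z p.
  move=> pA; have [_ Lp pU _] := atomsP _ _ _ _ pA.
  transitivity (\sum_(e in p :\: L) z p / #|p :\: L|%:R).
    apply: eq_bigr => e; rewrite inE => /andP[eL ep].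
    by rewrite /m1 inE eL (subsetP pU) //= (atomE fL pA).
  rewrite sumr_const -[LHS]mulr_natr divfK // pnatr_eq0 cards_eq0 setD_eq0.
  by have := atom_proper pA; rewrite properE => /andP[].
have m1L F : F \subset L -> msum m1 F = 0.
  by move=> FL; apply: big1 => e eF; rewrite /m1 inE (subsetP FL).
have m1U F : U \subset F -> msum m1 F = 0.
  move=> UF; rewrite /msum (big_setID U) /= (setIidPr UF) [X in _ + X]big1.
    rewrite addr0 (big_setID L) /= (setIidPr LsU) -/(msum m1 L) m1L // add0r.
    by rewrite -(sum_atoms m1 fL fU LsU) -[RHS]zP; apply: eq_bigr => p /m1p.
  by move=> e; rewrite inE => /andP[eU _]; rewrite /m1 inE (negPf eU) andbF.
exists (fun F => z F - msum m1 F); split.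
- rewrite lin_mod //.
  by rewrite -[RHS](m1U setT) ?subsetT //; apply: eq_bigl => e; rewrite inE.
- move=> F FS; have FS' := in_extS FS; rewrite z_ext //.
  by have /orP[/m1L->|/m1U->] := adjF F FS'; rewrite subrr.
move=> p pA; have [_ Lp pU _] := atomsP _ _ _ _ pA.
have : msum m1 p - msum m1 L = z p.
  by rewrite -(m1p p pA) /msum (big_setID L) /= (setIidPr Lp); ring.
by rewrite (m1L L) // subr0 => ->; rewrite subrr.
Qed.

Definition hodge S k := forall c, D (xs S * lin c * l ^+ k.+1) = 0 ->
  D (xs S * lin c * lin c * l ^+ k) <= 0.

(** When the excess vanishes, the coefficients can be cleared on the atoms and only
    self-intersections remain, nonpositive by [D_diag]. As [l] has positive square, its excess is
    nonzero; a class orthogonal to [l] moves into this hyperplane by a multiple of [l], and this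
    cannot decrease its square. *)
Lemma hodge_base S : chain S -> (#|S|.+2 = d)%N -> hodge S 0.
Proof.
move=> cS cardS c; rewrite expr1 expr0 mulr1 => ort.
have [|F0 F0S] := lk_ex loopM rkT cS; first by rewrite -cardS.
have [L [U [adj LF0 F0U]]] := lk_gap loopM rkT cS F0S.
have [LS US LU adjF] := adj.
have fL := ext_flat loopM cS LS; have fU := ext_flat loopM cS US.
have fF0 : flat F0 by case/lkP: F0S => /pflat_flat.
have rLF := rk_proper fL LF0; have rFU := rk_proper fF0 F0U.
have neg c' : excess c' L U = 0 -> D (xs S * lin c' * lin c') <= 0.
  move=> /(clear_atoms cS adj)[z [<- zS zP]].
  rewrite xs_lin // mulr_suml Dsum; apply: sumr_le0 => F FS; rewrite -mulrA DZ.
  have [FP|nFP] := boolP (F \in atoms M L U); first by rewrite zP // mul0r.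
  have cFS := chainU1 cS FS.
  have zF : {in F |: S, forall G, G != F -> z G = 0}.
    by move=> G; rewrite !inE => /orP[->//|GS _]; apply: zS.
  rewrite (@D_xs_lin_at (F |: S) z F cFS _ zF) ?setU11 // big1 ?addr0 => [|G GS].
    rewrite mulrA -expr2 mulr_ge0_le0 ?sqr_ge0 //.
    by apply: D_diag => //; [rewrite (card_lkU1 FS)|exact: setU11].
  suff GP : G \in atoms M L U by rewrite zP // mul0r.
  have cGFS := chainU1 cFS GS.
  have inP K := @atom_of_rank _ M loopM S L U K cS adj (leq_ltn_trans rLF rFU).
  (* The chain [G |: (F |: S)] has [d] members, so one of them has the rank of the atoms; it can
     only be [G]. *)
  have [||K KT rK] := @chain_hit _ _ _ loopM rkT _ (r L).+1 cGFS.
  - by rewrite (card_lkU1 GS) (card_lkU1 FS).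
  - rewrite /= (leq_trans rLF) //; case/lkP: F0S => /(pflat_rk loopM rkT) /andP[_ //].
  case/setU1P: KT => [eK|/setU1P[eK|KS]].
  - by apply: inP; [apply: lk_setU1 GS|rewrite -eK].
  - by case/negP: nFP; apply: inP => //; rewrite -eK.
  - have /orP[KL|UK] := adjF K (in_extS KS).
      by have := rk_mono M KL; rewrite rK ltnn.
    have := rk_mono M UK; rewrite rK => h.
    by have := leq_trans rFU h; rewrite ltnS leqNgt rLF.
have ll : 0 < D (xs S * l * l).
  by rewrite -mulrA -expr2; apply: D_pos => //; rewrite addn2.
have al : excess a L U != 0.
  by apply: contraTneq ll => /neg; rewrite leNgt.
pose t := excess c L U / excess a L U.
have /neg : excess (fun F => c F - t * a F) L U = 0 by rewrite excessB divfK ?subrr.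
rewrite linB linZ.
have -> : xs S * (lin c - iota t * l) * (lin c - iota t * l) =
   xs S * lin c * lin c + (iota (t ^+ 2) * (xs S * l * l) + - (iota (2 * t) * (xs S * lin c * l))).
  by rewrite rmorphXn rmorphM rmorph_nat; ring.
rewrite !DD DN !DZ ort mulr0 oppr0 addr0; apply: le_trans.
by rewrite lerDl mulr_ge0 ?sqr_ge0 // ltW.
Qed.

(** * The induction for the Hodge index inequality *)

Lemma D_xs_lin S c y : chain S -> {in S, forall F, c F = 0} ->
  D (xs S * lin c * y) = \sum_(F in lk S) c F * D (xs S * x F * y).
Proof.
move=> cS c0; rewrite xs_lin // mulr_suml Dsum; apply: eq_bigr => F /lkP[_ FS _].
by rewrite xsU1 // -mulrA DZ [x F * _]mulrC.
Qed.

Lemma D_linBZ u c c' t v :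
  D (u * lin (fun F => c F - t * c' F) * v) = D (u * lin c * v) - t * D (u * lin c' * v).
Proof.
rewrite linB linZ -DZ -DN -DD; congr (D _); ring.
Qed.

Lemma D_sqrB u c c' t v :
  D (u * lin (fun F => c F - t * c' F) * lin (fun F => c F - t * c' F) * v) =
  D (u * lin c * lin c * v) - 2 * t * D (u * lin c * lin c' * v)
    + t ^+ 2 * D (u * lin c' * lin c' * v).
Proof.
rewrite linB linZ -!DZ -DN -!DD; congr (D _).
by rewrite rmorphXn rmorphM rmorph_nat; ring.
Qed.

(** Reversed Cauchy-Schwarz: [hodge] is applied to the component of [c] orthogonal to [l], obtained
    by subtracting [p / v] times [l]. *)
Lemma hodge_cs S k c : hodge S k -> 0 < D (xs S * l ^+ k.+2) ->
  D (xs S * lin c * lin c * l ^+ k) <=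
  D (xs S * lin c * l ^+ k.+1) ^+ 2 / D (xs S * l ^+ k.+2).
Proof.
set v := D (xs S * l ^+ k.+2); set p := D (xs S * lin c * l ^+ k.+1) => hS v0.
have vE : D (xs S * l * l ^+ k.+1) = v by rewrite -mulrA -exprS.
have pE : D (xs S * lin c * l * l ^+ k) = p by rewrite -mulrA -exprS.
have := hS (fun F => c F - p / v * a F).
rewrite D_linBZ vE divfK ?gt_eqF // subrr => /(_ erefl).
rewrite D_sqrB pE -[xs S * l * l * _]mulrA -exprS vE.
rewrite (_ : _ - _ + _ = D (xs S * lin c * lin c * l ^+ k) - p ^+ 2 / v).
  by rewrite subr_le0.
by field; rewrite gt_eqF.
Qed.

Definition vecfun S (f : 'I_#|lk S| -> R) F := \sum_i f i * (F == enum_val i)%:R.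

Lemma vecfunE S (f : 'I_#|lk S| -> R) i : vecfun f (enum_val i) = f i.
Proof.
rewrite /vecfun (bigD1 i) //= eqxx mulr1 big1 ?addr0 // => j nij.
by rewrite (inj_eq enum_val_inj) eq_sym (negPf nij) mulr0.
Qed.

Lemma vecfun0 S (f : 'I_#|lk S| -> R) F : F \notin lk S -> vecfun f F = 0.
Proof.
move=> FS; apply: big1 => i _; case: eqVneq => [eF|_]; last by rewrite mulr0.
by rewrite eF enum_valP in FS.
Qed.

Lemma sum_lk S (f : {set E} -> R) :
  \sum_(F in lk S) f F = \sum_(i < #|lk S|) f (enum_val i).
Proof. exact: big_enum_val. Qed.

Lemma enum_val_ex S F : F \in lk S -> exists i : 'I_#|lk S|, F = enum_val i.
Proof. by move=> FS; exists (enum_rank_in FS F); rewrite enum_rankK_in. Qed.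

(* Bochner's method: the form of [S] is the combination, with the positive
   coefficients of [l], of the forms of the chains [F |: S]. *)
Lemma hodge_step S k : chain S -> (#|S|.+2 + k.+1 = d)%N ->
  {in lk S, forall F, hodge (F |: S) k} -> hodge S k.+1.
Proof.
move=> cS cardS hF c0; have [c [<- cz]] := lin_vanishing c0 cS => ort.
have [b [bl bz b_gt0]] := ample_at cS.
have eSD F y : F \in lk S -> D (xs S * x F * y) = D (xs (F |: S) * y).
  by case/lkP=> _ nF _; rewrite xsU1 // [x F * _]mulrC.
pose m (i j : 'I_#|lk S|) : R := D (xs S * x (enum_val i) * x (enum_val j) * l ^+ k.+1).
pose w (i : 'I_#|lk S|) := b (enum_val i).
have row z i : {in S, forall F, z F = 0} ->
    \sum_j m i j * z (enum_val j) = D (xs (enum_val i |: S) * lin z * l ^+ k.+1).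
  move=> z0; rewrite -[X in _ = D X]mulrA -eSD; last exact: enum_valP.
  rewrite (_ : _ * (lin z * _) = xs S * lin z * (x (enum_val i) * l ^+ k.+1)); last by ring.
  rewrite D_xs_lin // sum_lk.
  apply: eq_bigr => j _; rewrite mulrC /m; congr (_ * D _); ring.
have vE i : \sum_j m i j * w j = D (xs (enum_val i |: S) * l ^+ k.+2).
  by rewrite row // bl -mulrA -exprS.
have quad z : {in S, forall F, z F = 0} ->
    \sum_i \sum_j z (enum_val i) * m i j * z (enum_val j) =
    D (xs S * lin z * lin z * l ^+ k.+1).
  move=> z0; rewrite -[X in D X]mulrA D_xs_lin // sum_lk; apply: eq_bigr => i _.
  rewrite eSD ?enum_valP // mulrA -row // mulr_sumr.
  by apply: eq_bigr => j _; rewrite mulrA.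
have v_gt0 i : 0 < \sum_j m i j * w j.
  rewrite vE; apply: D_pos; first exact: chainU1 cS (enum_valP i).
  by rewrite (card_lkU1 (enum_valP i)) -cardS !addSn !addnS.
rewrite -(quad c cz); apply: (@one_positive R _ m w).
- by move=> i j; rewrite /m; congr (D _); ring.
- by move=> i; apply: b_gt0 (enum_valP i).
- move=> i j nij; apply: D_ge0 => //; try exact: enum_valP.
  by rewrite (inj_eq enum_val_inj).
- exact: v_gt0.
(* The hypothesis [quad_le]: one factor [l] is expanded with the coefficients [b], and [hodge_cs]
   applies to each chain [F |: S]. *)
- move=> z; pose cz' := vecfun z.
  have zS : {in S, forall F, cz' F = 0}.
    by move=> F FS; apply: vecfun0; apply/negP => /lkP[_ /negP].
  have zE i : z i = cz' (enum_val i) by rewrite /cz' vecfunE.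
  have -> : \sum_i \sum_j z i * m i j * z j = D (xs S * lin cz' * lin cz' * l ^+ k.+1).
    by rewrite -quad //; apply: eq_bigr => i _; apply: eq_bigr => j _; rewrite !zE.
  have rowz i : \sum_j m i j * z j = D (xs (enum_val i |: S) * lin cz' * l ^+ k.+1).
    by rewrite -row //; apply: eq_bigr => j _; rewrite zE.
  rewrite exprS mulrA -{1}bl.
  rewrite (_ : _ * _ * lin b * _ = xs S * lin b * (lin cz' * lin cz' * l ^+ k)); last by ring.
  rewrite D_xs_lin // sum_lk; apply: ler_sum => i _.
  rewrite rowz vE eSD ?enum_valP // -/(w i) -[X in _ <= X]mulrA.
  have -> : xs (enum_val i |: S) * (lin cz' * lin cz' * l ^+ k) =
    xs (enum_val i |: S) * lin cz' * lin cz' * l ^+ k by ring.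
  have wi : 0 < w i by apply: b_gt0 (enum_valP i).
  rewrite ler_pM2l // [X in _ <= X]mulrC.
  apply: hodge_cs; first exact: hF (enum_valP i).
  by rewrite -vE.
(* Distinct comparable flats of the link have a positive entry, so connectedness comes from
   [lk_connected]. *)
- move=> f hf i j; rewrite -(vecfunE f i) -(vecfunE f j).
  apply: (lk_connected loopM rkT cS); try exact: enum_valP.
    by rewrite -cardS leq_addr.
  move=> F G /enum_val_ex[{}i ->] /enum_val_ex[{}j ->] c_ij.
  have [->//|nij] := eqVneq i j.
  rewrite !vecfunE; apply: hf => //; apply: D_gt0 => //; try exact: enum_valP.
  by rewrite (inj_eq enum_val_inj).
(* The weighted row sums are degrees against powers of [l], so the remaining condition is the
   assumed orthogonality. *)
rewrite -[RHS]ort D_xs_lin // sum_lk.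
by apply: eq_bigr => i _; rewrite vE eSD ?enum_valP.
Qed.

Lemma hodge_all k S : chain S -> (#|S|.+2 + k = d)%N -> hodge S k.
Proof.
elim: k S => [|k IHk] S cS cardS; first by apply: hodge_base; rewrite // -cardS addn0.
apply: hodge_step => // F FS; apply: IHk; first exact: chainU1.
by rewrite (card_lkU1 FS) -cardS addSnnS.
Qed.

(** * The kernel of the degree-one form *)

Definition in_kernel S k c := forall c', D (xs S * lin c * lin c' * l ^+ k) = 0.

(** On the complement of [l] the form is negative semidefinite, so a null vector there is orthogonal
    to the whole complement; it is orthogonal to [l] as well. *)
Lemma hodge_null S k c : hodge S k -> 0 < D (xs S * l ^+ k.+2) ->
  D (xs S * lin c * l ^+ k.+1) = 0 -> D (xs S * lin c * lin c * l ^+ k) = 0 ->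
  in_kernel S k c.
Proof.
set v := D (xs S * l ^+ k.+2) => hS v0 c_l cc c'.
set p := D (_ * _ * lin c' * _).
have vE : D (xs S * l * l ^+ k.+1) = v by rewrite -mulrA -exprS.
pose t := D (xs S * lin c' * l ^+ k.+1) / v.
pose z F := c' F - t * a F.
have zl : D (xs S * lin z * l ^+ k.+1) = 0.
  by rewrite D_linBZ vE divfK ?gt_eqF // subrr.
have pz : D (xs S * lin c * lin z * l ^+ k) = p.
  by rewrite D_linBZ -[xs S * _ * l * _]mulrA -exprS c_l mulr0 subr0.
set w := D (xs S * lin z * lin z * l ^+ k).
have w0 : w <= 0 by apply: hS.
have h s : 0 - 2 * s * p + s ^+ 2 * w <= 0.
  have := hS (fun F => c F - s * z F).
  by rewrite D_linBZ c_l zl mulr0 subr0 D_sqrB cc pz => /(_ erefl).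
have w1 : 0 < 1 - w by lra.
(* This [s] makes the quadratic a positive multiple of [p ^+ 2]. The optimal choice would have [- w]
   in the denominator, but [w] may be zero. *)
have := h (- p / (1 - w)).
have -> : 0 - 2 * (- p / (1 - w)) * p + (- p / (1 - w)) ^+ 2 * w =
   p ^+ 2 * ((2 - w) / (1 - w) ^+ 2) by field; rewrite gt_eqF.
have pos : 0 < (2 - w) / (1 - w) ^+ 2 by rewrite divr_gt0 ?exprn_gt0 //; lra.
rewrite pmulr_lle0 // => p2; apply/eqP; rewrite -sqrf_eq0 eq_le p2; exact: sqr_ge0.
Qed.

(** Expanding one [l] with the positive coefficients [b] writes 0 as a positive combination of the
    nonpositive squares of [c] in the chains [F |: S]. All of them vanish, and [hodge_null]
    applies. *)
Lemma kernel_descend S k c : chain S -> (#|S|.+2 + k.+1 = d)%N ->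
  in_kernel S k.+1 c -> {in lk S, forall F, in_kernel (F |: S) k c}.
Proof.
move=> cS cardS kc.
have [b [bl bz b_gt0]] := ample_at cS.
have cardF F : F \in lk S -> (#|F |: S|.+2 + k = d)%N.
  by move=> FS; rewrite (card_lkU1 FS) -cardS addSnnS.
have hF F : F \in lk S -> hodge (F |: S) k.
  by move=> FS; apply: hodge_all; [apply: chainU1|apply: cardF].
have eSD F y : F \in lk S -> D (xs S * x F * y) = D (xs (F |: S) * y).
  by case/lkP=> _ nF _; rewrite xsU1 // [x F * _]mulrC.
have ortF F : F \in lk S -> D (xs (F |: S) * lin c * l ^+ k.+1) = 0.
  move=> FS; have [pF _ _] := lkP _ _ _ FS; rewrite -mulrA -eSD //.
  by rewrite -[RHS](kc (fun G => (G == F)%:R)) lin_delta //; congr (D _); ring.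
have qF F : F \in lk S -> D (xs (F |: S) * lin c * lin c * l ^+ k) <= 0.
  by move=> FS; apply: hF => //; apply: ortF.
have sum0 : \sum_(F in lk S) b F * - D (xs (F |: S) * lin c * lin c * l ^+ k) = 0.
  under eq_bigr => F FS do rewrite mulrN -!mulrA -eSD //.
  rewrite sumrN -(D_xs_lin _ cS bz) bl -[RHS]oppr0 -(kc c).
  by congr (- D _); rewrite exprS; ring.
move=> F FS; apply: hodge_null; [exact: hF| |exact: ortF|].
  apply: D_pos; first exact: chainU1.
  by rewrite -[RHS](cardF F FS) !addnS !addSn.
have ge G : G \in lk S -> 0 <= b G * - D (xs (G |: S) * lin c * lin c * l ^+ k).
  by move=> GS; rewrite mulr_ge0 ?oppr_ge0 ?qF // ltW // b_gt0.
have /(_ F FS)/eqP := psumr_eq0P ge sum0.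
by rewrite mulf_eq0 gt_eqF ?b_gt0 //= oppr_eq0 => /eqP.
Qed.

Lemma lk_within S T : chain T -> S \proper T -> exists2 F, F \in T & F \in lk S.
Proof.
move=> cT /properP[ST [F FT FS]]; exists F => //.
have /lkP[pF _ hF] := lk_of_chain cT FT; apply/lkP; split=> // G GS; apply: hF.
by rewrite !inE (subsetP ST) // andbT; apply: contraNneq FS => <-.
Qed.

(** Descend along [T] one member at a time; the last missing member serves as second argument of the
    form. *)
Lemma kernel_chain k S T c : chain T -> S \subset T -> (#|S|.+2 + k = d)%N ->
  (#|T|.+1 = d)%N -> in_kernel S k c -> D (xs T * lin c) = 0.
Proof.
elim: k S => [|k IHk] S cT ST cardS cardT kc; have cS := chainS ST cT.
all: have [|F FT FlS] := @lk_within S T cT.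
1,3: rewrite properEcard ST /=; move: cardT; rewrite -cardS !addSn => -[->].
1,2: by rewrite ltnS leq_addr.
all: have FST : F |: S \subset T by rewrite subUset sub1set FT.
  have [pF FS _] := lkP _ _ _ FlS.
  have -> : T = F |: S.
    apply/eqP; rewrite eq_sym eqEcard FST (card_lkU1 FlS) /=.
    by move: cardT; rewrite -cardS addn0 => -[->].
  rewrite xsU1 // -[RHS](kc (fun G => (G == F)%:R)) lin_delta // expr0 mulr1.
  by congr (D _); ring.
apply: (IHk (F |: S)) => //; first by rewrite (card_lkU1 FlS) -cardS addSnnS.
exact: kernel_descend.
Qed.

Lemma xs_corank1 S L U c : chain S -> (#|S|.+1 = d)%N -> adjacent S L U ->
  r U = (r L).+2 -> D (xs S * lin c) = excess c L U.
Proof.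
move=> cS cardS adj rU; have [z [<- z_ext <-]] := excess_sum c cS adj.
rewrite xs_lin //; last by move=> F /in_extS/z_ext.
rewrite Dsum (lk_rank2 loopM rkT cS cardS adj rU); apply: eq_bigr => p pA.
have pS : p \in lk S by rewrite (lk_rank2 loopM rkT cS cardS adj rU).
rewrite DZ D_chain ?mulr1 //; first exact: chainU1.
by rewrite (card_lkU1 pS).
Qed.

Lemma excess_additive c : (forall L U, flat L -> flat U -> L \subset U ->
    r U = (r L).+2 -> excess c L U = 0) ->
  forall H, flat H -> H != set0 -> restr c H = \sum_(p in atoms M set0 H) restr c p.
Proof.
move=> ex0 H fH H0.
have := atoms_additive (M := M) (g := restr c) _ (n := (r H).-1) (flat0 loopM) fH (sub0set H).
rewrite restr0 subr0 => <- //.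
- by apply: eq_bigr => p _; rewrite subr0.
- by move=> F K fF fK FK rK; apply/eqP; rewrite -subr_eq0; apply/eqP/ex0.
by rewrite rk_set0 prednK // -(rk_set0 M) (rk_proper (flat0 loopM)) // proper0.
Qed.

(** The pairings say that the excess vanishes on rank-two intervals, and [atoms_additive] extends
    this to the interval from [set0] to [setT]. Hence the coefficients can be cleared on the flats
    of rank one, and additivity then clears them everywhere. *)
Lemma lin_eq0 c : (forall T, chain T -> (#|T|.+1 = d)%N -> D (xs T * lin c) = 0) ->
  lin c = 0.
Proof.
move=> h.
have ex0 z : lin z = lin c -> forall L U, flat L -> flat U -> L \subset U ->
    r U = (r L).+2 -> excess z L U = 0.
  move=> zc L U fL fU LU rU; have [S [cS cardS adj]] := interval_chain loopM rkT fL fU LU rU.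
  by rewrite -(xs_corank1 z cS cardS adj rU) zc h.
have ET : ([set: E] != set0) by apply/eqP => eT; move: rkT; rewrite eT rk_set0.
have adj0 : adjacent set0 (set0 : {set E}) setT.
  by split; rewrite ?in_ext0 ?in_extT ?proper0 // => F; rewrite !inE subset0 subTset orbF.
have [|z [zc _ zP]] := clear_atoms (c := c) (chain0 M) adj0.
  rewrite /excess; apply/eqP; rewrite subr_eq0; apply/eqP.
  rewrite restr0 restrT subr0 -[RHS](restrT c).
  by rewrite (excess_additive (ex0 c erefl) (flatT M) ET); apply: eq_bigr => p _; rewrite subr0.
rewrite -zc; apply: big1 => H pH; have [fH H0 HT] := pflatP _ _ pH.
rewrite -(restrE z pH) (excess_additive (ex0 z zc)) -?proper0 // big1 ?rmorph0 ?mul0r // => p pA.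
rewrite restrE; last first.
  apply: (rk_pflat rkT); case/atomsP: pA => // _ _ _ ->; rewrite rk_set0 /=.
  by have /andP[] := pflat_rk loopM rkT pH; apply: leq_trans.
by apply: zP; apply: atom_trans pA (subsetT _).
Qed.

(** * Dependence of chain monomials on the chain *)

Lemma msum_indicator i j F :
  msum (fun w => (w == i)%:R - (w == j)%:R) F = (i \in F)%:R - (j \in F)%:R.
Proof. by rewrite /msum sumrB !sum_indicator. Qed.

Definition between F K := [set G | [&& flat G, F \proper G & G \proper K]].

(** The difference of the two sides is [xs S] times the linear relation of [i] and [j]: a flat of
    the link outside this gap contains both elements or neither. *)
Lemma gap_relation S F K i j : chain S -> adjacent S F K -> i \in K :\: F -> j \in K :\: F ->
  xs S * \sum_(G in between F K | i \in G) x G = xs S * \sum_(G in between F K | j \in G) x G.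
Proof.
move=> cS adj; rewrite !inE => /andP[iF iK] /andP[jF jK]; have [FS KS _ adjF] := adj.
have fF := ext_flat loopM cS FS; have fK := ext_flat loopM cS KS.
pose m w : R := (w == i)%:R - (w == j)%:R.
have mS : {in S, forall G, msum m G = 0}.
  move=> G GS; rewrite msum_indicator; have /orP[GF|KG] := adjF G (in_extS GS).
    by rewrite (negPf (contra (subsetP GF i) iF)) (negPf (contra (subsetP GF j) jF)) subrr.
  by rewrite !(subsetP KG) ?subrr.
have m0 : \sum_w m w = 0 by rewrite sumrB !sum_indicator subrr.
apply/eqP; rewrite -subr_eq0 -mulrBr; apply/eqP.
rewrite [X in _ * (X - _)]big_mkcondr [X in _ * (_ - X)]big_mkcondr -sumrB mulr_sumr.
transitivity (xs S * lin (msum m)); last by rewrite lin_msum ?mulr0.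
rewrite xs_lin // [LHS]big_mkcond [RHS]big_mkcond; apply: eq_bigr => G _.
have [GB|nGB] := ifP.
  move: GB; rewrite inE => /and3P[fG FG GK].
  have GS := lk_between adj fG FG GK; rewrite GS msum_indicator.
  have [_ nGS _] := lkP _ _ _ GS; rewrite xsU1 // rmorphB !rmorph_nat.
  by case: (i \in G); case: (j \in G) => /=; ring.
case: ifP => // GS; have fG : flat G by case/lkP: GS => /pflat_flat.
rewrite msum_indicator.
suff -> : (i \in G) = (j \in G) by rewrite subrr rmorph0 mul0r.
have /orP[GF|FG] := lk_ext_cmp GS FS; last first.
  by rewrite (negPf (contra (subsetP FG i) iF)) (negPf (contra (subsetP FG j) jF)).
have /orP[KG|GK] := lk_ext_cmp GS KS; first by rewrite !(subsetP KG).
move: nGB; rewrite inE fG !properEneq GF GK !andbT /= => /negP/negP.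
rewrite negb_and !negbK => /orP[/eqP <-|/eqP ->]; last by rewrite iK jK.
by rewrite (negPf iF) (negPf jF).
Qed.

Lemma between_rank2 F K : flat F -> flat K -> F \subset K -> r K = (r F).+2 ->
  between F K = atoms M F K.
Proof.
move=> fF fK FK rK; apply/setP => G; rewrite [LHS]inE; apply/and3P/idP => [[fG FG GK]|GA].
  exact: atom_rank2.
split; [by case/atomsP: GA|exact: atom_proper GA|].
by apply: atom_properR GA; rewrite rK.
Qed.

(** In a rank-two gap each element of [K :\: F] lies in exactly one atom, so both sums of
    [gap_relation] reduce to a single atom. *)
Lemma exchange F K p q : flat F -> flat K -> r K = (r F).+2 ->
  p \in atoms M F K -> q \in atoms M F K -> x F * x p * x K = x F * x q * x K.
Proof.
move=> fF fK rK pA qA; have [fp Fp pK rp] := atomsP _ _ _ _ pA.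
have FK : F \subset K := subset_trans Fp pK.
have pFK : F \proper K by apply: proper_sub_trans (atom_proper pA) pK.
pose S := ends M F K.
have cS : chain S := chain_ends M FK.
have adj : adjacent S F K := adjacent_ends fF fK pFK.
have xF1 G : flat G -> ~~ pfl G -> x G = 1.
  by rewrite /is_pflat => -> /=; rewrite negb_and !negbK => /orP[]/eqP->.
have xsS : xs S = x F * x K.
  have nFK : F != K by apply: contraTneq pFK => ->; rewrite properxx.
  rewrite /xs (eq_bigl (fun G => (G \in [set F; K]) && pfl G)); last by move=> G; rewrite inE.
  rewrite big_mkcondr /= (eq_bigr x); last first.
    move=> G; rewrite !inE => /orP[]/eqP->; case: ifP => // /negbT/xF1 -> //.
  by rewrite big_setU1 ?inE //= big_set1.
have sumE s : s \in atoms M F K -> exists2 i, i \in K :\: F &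
    \sum_(G in between F K | i \in G) x G = x s.
  move=> sA; have [fs Fs sK rs] := atomsP _ _ _ _ sA.
  have /properP[_ [i iS iF]] := atom_proper sA.
  exists i; first by rewrite inE iF (subsetP sK).
  rewrite between_rank2 // (bigD1 s) /= ?sA // big1 ?addr0 // => G.
  by move=> /andP[/andP[GA iG]]; rewrite -(atomE fF GA iG iF) (atomE fF sA iS iF) eqxx.
have [i iK <-] := sumE p pA; have [j jK <-] := sumE q qA.
by rewrite [LHS]mulrAC [RHS]mulrAC -xsS; apply: gap_relation.
Qed.

Definition cover G K := [&& flat G, flat K, G \subset K & r K == (r G).+1].

Definition px (s : seq {set E}) : A := \prod_(G <- s) x G.

Lemma cover_path_flat F s : path cover F s -> flat F -> flat (last F s) /\ F \subset last F s.
Proof.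
elim: s F => [|G s IHs] F //= /andP[/and4P[_ fG FG _] ps] fF.
by have [? Gl] := IHs G ps fG; split=> //; apply: subset_trans Gl.
Qed.

Lemma cover_path_rank F s : path cover F s -> r (last F s) = (r F + size s)%N.
Proof.
elim: s F => [|G s IHs] F /=; first by rewrite addn0.
by move=> /andP[/and4P[_ _ _ /eqP rG] /IHs ->]; rewrite rG addnS addSn.
Qed.

Lemma cover_path_ex n F H : flat F -> flat H -> F \subset H -> r H = (r F + n)%N ->
  exists2 s, path cover F s & last F s = H.
Proof.
elim: n F => [|n IHn] F fF fH FH rH.
  by exists [::] => //=; apply: (flat_eq fF); rewrite // rH addn0.
have [G [fG FG GH rG]] : exists G, [/\ flat G, F \subset G, G \subset H & r G = (r F).+1].
  by apply: (exists_flat_between fF fH); rewrite // leqnSn rH addnS ltnS leq_addr.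
have [|s ps ls] := IHn G fG fH GH; first by rewrite rH rG addnS addSn.
by exists (G :: s) => //=; rewrite ps /cover fF fG FG rG eqxx.
Qed.

(* Two saturated chains with the same ends differ by rank-two exchanges. *)
Lemma px_path n F s t : size s = n -> path cover F s -> path cover F t ->
  last F s = last F t -> x F * px s = x F * px t.
Proof.
elim: n F s t => [|n IHn] F s t sn ps pt lst.
  have := cover_path_rank ps; rewrite lst (cover_path_rank pt) sn.
  by move/addnI/size0nil ->; move/size0nil: sn => ->.
have tn : size t = n.+1.
  by have := cover_path_rank ps; rewrite lst (cover_path_rank pt) sn => /addnI.
case: s sn ps lst => //= G s [sn] /andP[cG ps].
case: t tn pt => //= G' t [tn] /andP[cG' pt] lst.
have [fF fG FG rG] := and4P cG; have [_ fG' FG' rG'] := and4P cG'.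
have pxE K u : px (K :: u) = x K * px u by rewrite /px big_cons.
have [eG|nG] := eqVneq G G'.
  by subst G'; rewrite !pxE (IHn G s t sn ps pt lst).
set H := last G s in lst.
have [fH GH] := cover_path_flat ps fG; have [_ G'H] := cover_path_flat pt fG'.
rewrite -/H in fH GH; rewrite -lst in G'H.
have GA : G \in atoms M F H by apply/atomsP; rewrite (eqP rG).
have G'A : G' \in atoms M F H by apply/atomsP; rewrite (eqP rG').
(* Both paths are rerouted through the join [K] of their first steps and a common path [u] from [K]
   to [H]; the new paths differ by one exchange. *)
have KA := atomU_closure fF fH GA G'A nG.
have KA' : mclosure M (G :|: G') \in atoms M G H.
  by rewrite setUC; apply: (atomU_closure fF fH) => //; rewrite eq_sym.
move: (mclosure M _) KA KA' => K KA KA'.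
have [fK G'K KH rK] := atomsP _ _ _ _ KA; have [_ GK _ rK'] := atomsP _ _ _ _ KA'.
have rH := cover_path_rank ps; rewrite -/H sn in rH.
have n0 : (0 < n)%N.
  by have := rk_mono M KH; rewrite rK' rH -addn1 leq_add2l.
have [|u pu lu] := @cover_path_ex n.-1 K H fK fH KH.
  by rewrite rH rK' addSn -addnS prednK.
have pKu (H0 : {set E}) : cover H0 K -> path cover H0 (K :: u) by move=> cT /=; rewrite cT.
have cGK : cover G K by rewrite /cover fG fK GK rK' eqxx.
have cGK' : cover G' K by rewrite /cover fG' fK G'K rK eqxx.
rewrite !pxE (IHn G s (K :: u) sn ps (pKu G cGK) (esym lu)).
rewrite (IHn G' t (K :: u) tn pt (pKu G' cGK') (etrans (esym lst) (esym lu))) !pxE !mulrA; congr (_ * _).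
apply: exchange => //; first by rewrite rK' (eqP rG).
  exact: atom_in GA KA'.
exact: atom_in G'A KA.
Qed.

(* A missing rank gives [set0], for which [x] is 1, so that [xs_rkel] holds
   whatever the ranks in [T]. *)
Definition rkel T t : {set E} := odflt set0 [pick G in ext T | r G == t].

Lemma rkelE T G : chain T -> G \in ext T -> rkel T (r G) = G.
Proof.
move=> cT GT; rewrite /rkel; case: pickP => [H /andP[HT /eqP rH]|/(_ G)]; last by rewrite GT eqxx.
have fH := ext_flat loopM cT HT; have fG := ext_flat loopM cT GT.
apply: (flat_eq fH); last by rewrite rH.
by apply: (cmp_rk fH fG); [apply: ext_cmp cT HT GT|rewrite rH].
Qed.

Lemma rkel_none T t : {in ext T, forall G, r G != t} -> rkel T t = set0.
Proof.
move=> h; rewrite /rkel; case: pickP => //= H /andP[/h]; by move/negPf->.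
Qed.

Lemma xs_rkel T : chain T -> xs T = \prod_(t < d.+2) x (rkel T t).
Proof.
move=> cT; have [pT _] := chainP _ _ cT.
rewrite /xs (partition_big (fun G => inord (r G) : 'I_d.+2) predT) //=.
apply: eq_bigr => t _.
have rE G : G \in T -> (inord (r G) == t) = (r G == t).
  move=> /pT/(pflat_rk loopM rkT)/andP[_ rG].
  by rewrite -val_eqE /= inordK // ltnS (leq_trans rG).
have [G /andP[GT /eqP rG]|no] := pickP (fun G => (G \in T) && (r G == t)).
  rewrite (big_pred1 G); first by rewrite -rG rkelE // in_extS.
  move=> H /=; apply/andP/eqP => [[HT]|->]; last by rewrite GT rE ?rG.
  rewrite rE // => /eqP rH.
  by rewrite -(rkelE cT (in_extS GT)) rG -rH rkelE // in_extS.
rewrite big_pred0; last first.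
  move=> G; apply/negP => /andP[GT]; rewrite rE // => h.
  by have := no G; rewrite GT h.
rewrite /rkel; case: pickP => [H|] /=; last by rewrite x0.
rewrite !inE => /andP[/or3P[/eqP->|/eqP->|HT] rH] //.
by have := no H; rewrite HT rH.
Qed.

Lemma rkel_path T m n : chain T -> (forall t, m <= t <= m + n -> exists2 G, G \in ext T & r G = t)%N ->
  path cover (rkel T m) [seq rkel T t | t <- seq.iota m.+1 n] /\
  last (rkel T m) [seq rkel T t | t <- seq.iota m.+1 n] = rkel T (m + n)%N.
Proof.
move=> cT; elim: n m => [|n IHn] m h; first by rewrite addn0.
have [|p1 p2] := IHn m.+1.
  by move=> t /andP[mt tn]; apply: h; rewrite (ltnW mt) addnS -addSn.
rewrite /= p1 p2 addnS addSn andbT; split=> //.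
have [|G GT rG] := h m; first by rewrite leqnn leq_addr.
have [|H HT rH] := h m.+1; first by rewrite leqnSn addnS ltnS leq_addr.
have fG := ext_flat loopM cT GT; have fH := ext_flat loopM cT HT.
rewrite -rH -[in rkel T m]rG !rkelE // /cover fG fH rG rH eqxx andbT.
by apply: (cmp_rk fG fH); [apply: ext_cmp cT GT HT|rewrite rG rH].
Qed.

Lemma prod_rkel T m n : chain T -> (forall t, m <= t <= m + n -> exists2 G, G \in ext T & r G = t)%N ->
  \prod_(m <= t < (m + n).+1) x (rkel T t) =
  x (rkel T m) * px [seq rkel T t | t <- seq.iota m.+1 n].
Proof.
move=> cT h; rewrite big_ltn ?ltnS ?leq_addr // /px big_map; congr (_ * _).
by rewrite /index_iota subSS addKn.
Qed.

(** Over a run of ranks without holes a chain is a cover path, so only its two end flats matter. *)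
Lemma prod_rkel_eq T T' m n : chain T -> chain T' ->
  (forall t, m <= t <= m + n -> exists2 G, G \in ext T & r G = t)%N ->
  (forall t, m <= t <= m + n -> exists2 G, G \in ext T' & r G = t)%N ->
  rkel T m = rkel T' m -> rkel T (m + n)%N = rkel T' (m + n)%N ->
  \prod_(m <= t < (m + n).+1) x (rkel T t) = \prod_(m <= t < (m + n).+1) x (rkel T' t).
Proof.
move=> cT cT' h h' e1 e2; rewrite !prod_rkel // -e1.
have [p1 l1] := rkel_path cT h; have [p2 l2] := rkel_path cT' h'.
rewrite -e1 in p2 l2.
by apply: (px_path (n := n)); rewrite ?size_map ?size_iota // l1 l2.
Qed.

Lemma rkel0 T : chain T -> rkel T 0%N = set0.
Proof. by move=> cT; rewrite -(rk_set0 M) rkelE // in_ext0. Qed.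

Lemma rkelT T : chain T -> rkel T d.+1 = setT.
Proof. by move=> cT; rewrite -rkT rkelE // in_extT. Qed.

Lemma ext_hit T t : chain T -> #|T| = d -> (t <= d.+1)%N -> exists2 G, G \in ext T & r G = t.
Proof.
move=> cT cardT; rewrite leq_eqVlt => /orP[/eqP->|]; first by exists setT; rewrite ?in_extT.
case: t => [|t] tn; first by exists set0; rewrite ?in_ext0 ?rk_set0.
by have [//|G GT rG] := chain_hit loopM rkT (t := t.+1) cT cardT; exists G; rewrite ?in_extS.
Qed.

Lemma xs_top T T' : chain T -> chain T' -> #|T| = d -> #|T'| = d -> xs T = xs T'.
Proof.
move=> cT cT' cardT cardT'; rewrite !xs_rkel // -!(big_mkord predT (fun t => x (rkel _ t))).
by apply: (@prod_rkel_eq T T' 0 d.+1) => //; rewrite ?rkel0 // ?add0n ?rkelT // => t /andP[_ td];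
   apply: ext_hit.
Qed.

Lemma corank1_hit T F K t : chain T -> #|T|.+1 = d -> adjacent T F K -> r K = (r F).+2 ->
  (t <= d.+1)%N -> t != (r F).+1 -> exists2 G, G \in ext T & r G = t.
Proof.
move=> cT cardT adj rK td nt; have [FT KT _ _] := adj.
have fF := ext_flat loopM cT FT; have fK := ext_flat loopM cT KT.
have [|p pT] := lk_ex loopM rkT cT; first by rewrite -cardT.
have rp : r p = (r F).+1.
  by move: pT; rewrite (lk_rank2 loopM rkT cT cardT adj rK) => /atomsP[].
have cardpT : #|p |: T| = d by rewrite (card_lkU1 pT).
have [G GT rG] := ext_hit (chainU1 cT pT) cardpT td.
exists G => //; move: GT; rewrite !inE => /or4P[->|->|/eqP eG|->]; rewrite ?orbT //.
by move: nt; rewrite -rG eG rp eqxx.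
Qed.

Lemma corank1_miss T F K : chain T -> adjacent T F K -> r K = (r F).+2 ->
  rkel T (r F).+1 = set0.
Proof.
move=> cT [FT KT _ adj] rK; apply: rkel_none => G /adj/orP[GF|KG].
  by rewrite neq_ltn ltnS rk_mono.
by have := rk_mono M KG; rewrite rK neq_ltn => ->; rewrite orbT.
Qed.

(** The only hole of either chain is the rank between [F] and [K], where the factor is 1. Below [F]
    and above [K] both chains are saturated with the same ends. *)
Lemma xs_corank1_eq T T' F K : chain T -> chain T' -> #|T|.+1 = d -> #|T'|.+1 = d ->
  adjacent T F K -> adjacent T' F K -> r K = (r F).+2 -> xs T = xs T'.
Proof.
move=> cT cT' cardT cardT' adj adj' rK; rewrite !xs_rkel //.
rewrite -!(big_mkord predT (fun t => x (rkel _ t))).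
have [FT KT _ _] := adj; have [FT' KT' _ _] := adj'.
have rKd : (r K <= d.+1)%N by rewrite -rkT rk_mono ?subsetT.
have rFd : (r F < d)%N by rewrite -(ltnS _ d) -rK.
have split3 S : rkel S (r F).+1 = set0 ->
    \prod_(0 <= t < d.+2) x (rkel S t) =
    (\prod_(0 <= t < (0 + r F).+1) x (rkel S t)) *
    \prod_(r K <= t < (r K + (d.+1 - r K)).+1) x (rkel S t).
  move=> miss; rewrite add0n subnKC // (@big_cat_nat _ _ _ (r F).+1) //=; last first.
    exact: leqW (leqW rFd).
  congr (_ * _); rewrite big_ltn ?miss ?x0 ?mul1r ?rK //.
  exact: leqW rFd.
rewrite !split3 ?(corank1_miss _ adj) ?(corank1_miss _ adj') //; congr (_ * _).
  apply: prod_rkel_eq; rewrite ?rkel0 ?add0n ?rkelE // => t /andP[_ tF].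
    apply: (corank1_hit cT cardT adj rK); last by rewrite neq_ltn ltnS tF.
    exact: leq_trans tF (leqW (ltnW rFd)).
  apply: (corank1_hit cT' cardT' adj' rK); last by rewrite neq_ltn ltnS tF.
  exact: leq_trans tF (leqW (ltnW rFd)).
apply: prod_rkel_eq; rewrite ?subnKC ?rkelT ?rkelE // => t /andP[Kt td].
  by apply: (corank1_hit cT cardT adj rK) => //; rewrite rK in Kt; rewrite neq_ltn Kt orbT.
by apply: (corank1_hit cT' cardT' adj' rK) => //; rewrite rK in Kt; rewrite neq_ltn Kt orbT.
Qed.

(** * Gap classes and their integration over the lattice of flats *)

Definition gapb F K T := [&& chain T, #|T|.+1 == d, F \in ext T, K \in ext T, F \proper K &
  [forall G in ext T, (G \subset F) || (K \subset G)]].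

Lemma gapbP F K T : reflect [/\ chain T, #|T|.+1 = d & adjacent T F K] (gapb F K T).
Proof.
apply: (iffP and5P) => [[cT /eqP cardT FT KT /andP[FK /forall_inP adj]]|].
  by split.
case=> cT cardT [FT KT FK adj]; split=> //; first exact/eqP.
by rewrite FK; apply/forall_inP.
Qed.

(* Independent of the choice of [T] when [r K = (r F).+2], see [gap_classE]. *)
Definition gap_class F K : A := if [pick T | gapb F K T] is Some T then xs T else 0.

Lemma gap_classE T F K : chain T -> #|T|.+1 = d -> adjacent T F K -> r K = (r F).+2 ->
  gap_class F K = xs T.
Proof.
move=> cT cardT adj rK; rewrite /gap_class; case: pickP => [T' /gapbP[cT' cardT' adj']|].
  exact: (xs_corank1_eq cT' cT cardT' cardT adj' adj rK).
by move/(_ T)/negbT/gapbP; case.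
Qed.

(** The compatibility condition for integration, which is [gap_relation] in a rank-three gap. Among
    the flats containing an element of [s :\: F], the atom [s] leaves the gap from [s] to [K], and
    the others are the covers [L] of [s], leaving the gaps from [F] to [L]. *)
Lemma gap_class_rank3 F K p q : flat F -> flat K -> r K = (r F).+3 ->
  p \in atoms M F K -> q \in atoms M F K ->
  gap_class p K + \sum_(L in atoms M p K) gap_class F L =
  gap_class q K + \sum_(L in atoms M q K) gap_class F L.
Proof.
move=> fF fK rK pA qA.
have FK : F \subset K by have [_ Fp pK _] := atomsP _ _ _ _ pA; apply: subset_trans pK.
have [S [cS cardS adj]] := interval_chain3 loopM rkT fF fK FK rK.
have side s : s \in atoms M F K -> exists2 i, i \in K :\: F &
    gap_class s K + \sum_(L in atoms M s K) gap_class F L =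
    xs S * \sum_(G in between F K | i \in G) x G.
  move=> sA; have [fs Fs sK rs] := atomsP _ _ _ _ sA; have pFs := atom_proper sA.
  have psK : s \proper K by apply: atom_properR sA; rewrite rK !ltnS.
  have sS := lk_between adj fs pFs psK.
  have /properP[_ [i iS iF]] := pFs; exists i; first by rewrite inE iF (subsetP sK).
  have [adj1 adj2] := adjacentU1 adj pFs psK.
  rewrite [X in _ = _ * X](bigD1 s) /=; last by rewrite inE fs pFs psK.
  rewrite mulrDr mulr_sumr; congr (_ + _).
    have [_ nsS _] := lkP _ _ _ sS; rewrite mulrC -xsU1 //.
    apply: gap_classE adj2 _; rewrite ?(card_lkU1 sS) //; first exact: chainU1.
    by rewrite rK rs.
  have AE G : (G \in between F K) && (i \in G) && (G != s) = (G \in atoms M s K).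
    apply/idP/idP => [|GA]; last first.
      have [fG sG GK rG] := atomsP _ _ _ _ GA.
      rewrite inE fG (proper_sub_trans pFs) // (subsetP sG) //.
      rewrite (atom_properR _ GA) ?rK ?rs //= eq_sym.
      by apply: contraTneq (atom_proper GA) => ->; rewrite properxx.
    rewrite inE => /andP[/andP[/and3P[fG FG GK] iG] nGs].
    have sG : s \subset G.
      by rewrite -(atomE fF sA iS iF) closure_min // subUset sub1set iG proper_sub.
    apply: atom_rank2 => //; first by rewrite rK rs.
    by rewrite properEneq eq_sym nGs.
  rewrite [RHS](eq_bigl _ _ AE); apply: eq_bigr => G GA.
  have [fG sG GK rG] := atomsP _ _ _ _ GA.
  have FG : F \proper G := proper_sub_trans pFs sG.
  have pGK : G \proper K by apply: atom_properR GA; rewrite rK rs.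
  have GS := lk_between adj fG FG pGK; have [adjG _] := adjacentU1 adj FG pGK.
  have [_ nGS _] := lkP _ _ _ GS; rewrite mulrC -xsU1 //.
  apply: gap_classE adjG _; rewrite ?(card_lkU1 GS) //; first exact: chainU1.
  by rewrite rG rs.
have [i iK ->] := side p pA; have [j jK ->] := side q qA.
exact: gap_relation.
Qed.

Definition defect (xi : {set E} -> A) F K : A :=
  \sum_(p in atoms M F K) (xi p - xi F) - (xi K - xi F).

Definition solves n (xi : {set E} -> A) := xi set0 = 0 /\
  forall F K, flat F -> flat K -> F \subset K -> r K = (r F).+2 -> (r K <= n)%N ->
    defect xi F K = gap_class F K.

(** The value at [K] forced by the equation for [defect] on the interval from [F] to [K]. *)
Definition next_value (xi : {set E} -> A) K F : A :=
  \sum_(p in atoms M F K) (xi p - xi F) + xi F - gap_class F K.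

(** Both values are rewritten in the rank-three interval from [H] to [K] by the equations on
    rank-two intervals starting at [H]; they then differ by the two sides of [gap_class_rank3]. *)
Lemma next_value_step n xi K F F' : solves n xi -> flat K -> r K = n.+1 ->
  flat F -> flat F' -> F \subset K -> F' \subset K -> (r F).+1 = n -> (r F').+1 = n ->
  r F = (r (F :&: F')).+1 -> next_value xi K F = next_value xi K F'.
Proof.
move=> [_ sol] fK rK fF fF' FK F'K rF rF' rI; set H := F :&: F' in rI.
have fH : flat H := flatI fF fF'.
have HK : H \subset K := subset_trans (subsetIl _ _) FK.
have rKH : r K = (r H).+3 by rewrite rK -rF rI.
have nextE G : G \in atoms M H K -> next_value xi K G =
    \sum_(q in atoms M H K) (xi q - xi H) + xi H -
    (gap_class G K + \sum_(L in atoms M G K) gap_class H L).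
  move=> GA; have [fG HG GK rG] := atomsP _ _ _ _ GA.
  rewrite /next_value; have -> : \sum_(p in atoms M G K) (xi p - xi G) =
      \sum_(p in atoms M G K) (\sum_(q in atoms M H p | q != G) (xi q - xi H) - gap_class H p).
    apply: eq_bigr => p pA; have [fp Gp pK rp] := atomsP _ _ _ _ pA.
    rewrite -sol //; last 3 first.
    - exact: subset_trans Gp.
    - by rewrite rp rG.
    - by rewrite rp rG -rI rF.
    rewrite /defect [X in _ = _ - (X - _)](bigD1 G) /=; last exact: atom_in GA pA.
    ring.
  rewrite sumrB -(sum_atoms_other _ fH fK GA) [X in _ = X + _ - _](bigD1 G) //=; ring.
have FA : F \in atoms M H K by apply/atomsP; rewrite subsetIl.
have F'A : F' \in atoms M H K.
  by apply/atomsP; rewrite subsetIr; split=> //; apply: succn_inj; rewrite rF' -rF rI.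
by rewrite !nextE // (gap_class_rank3 fH fK rKH FA F'A).
Qed.

(** Steps of the previous kind connect all choices. Let [H] be a hyperplane of [F] containing
    [F :&: F']; joined with an element of [F'] outside [F] it gives a flat [G] that meets [F] in [H]
    and meets [F'] in larger rank. *)
Lemma next_value_const n xi K F F' : solves n xi -> flat K -> r K = n.+1 ->
  flat F -> flat F' -> F \subset K -> F' \subset K -> (r F).+1 = n -> (r F').+1 = n ->
  next_value xi K F = next_value xi K F'.
Proof.
move=> sol fK rK; have [k] := ubnP (r F - r (F :&: F')); elim: k F => // k IHk F.
move=> lt fF fF' FK F'K rF rF'; have fI := flatI fF fF'.
have [le|lt0] := leqP (r F) (r (F :&: F')).
  have eI : F :&: F' = F by apply: (flat_eq fI (subsetIl _ _)).
  have FF' : F \subset F' by rewrite -eI subsetIr.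
  by rewrite (flat_eq fF FF') //; apply: eq_leq; apply: succn_inj; rewrite rF rF'.
have [H [fH IH HF rH]] : exists H, [/\ flat H, F :&: F' \subset H, H \subset F & r H = (r F).-1].
  apply: (exists_flat_between fI fF (subsetIl _ _)); rewrite leq_pred andbT -ltnS prednK //.
  exact: leq_ltn_trans lt0.
have /subsetPn[e eF' eF] : ~~ (F' \subset F).
  apply: contraTN lt0 => F'F; rewrite -leqNgt (setIidPr F'F).
  by rewrite -ltnS rF -rF' ltnS.
have eH : e \notin H by apply: contra eF => /(subsetP HF).
have eI : e \notin F :&: F' by rewrite inE (negPf eF).
pose G := mclosure M (e |: H).
have fG : flat G := flat_closure M _.
have rF0 : (0 < r F)%N by apply: leq_ltn_trans lt0.
have rG : r G = r F by rewrite rk_closureU1 // rH prednK.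
have GK : G \subset K by rewrite closure_min // subUset sub1set (subsetP F'K) // (subset_trans HF).
have rGn : (r G).+1 = n by rewrite rG.
have HFG : F :&: G = H.
  apply/eqP; rewrite eq_sym eqEsubset subsetI HF sub_closureU1 /=.
  have fFG := flatI fF fG.
  suff -> : H = F :&: G by [].
  apply: (flat_eq fH); first by rewrite subsetI HF sub_closureU1.
  rewrite -ltnS rH prednK //; apply: (rk_proper fFG).
  rewrite properEneq subsetIl andbT; apply: contra eF => /eqP/setIidPl FG.
  have -> : F = G by apply: (flat_eq fF FG); rewrite rG.
  exact: mem_closureU1.
rewrite (next_value_step sol fK rK fF fG FK GK) // ?HFG ?rH ?prednK //.
apply: IHk => //.
rewrite rG; apply: leq_trans (_ : r F - r (F :&: F') <= k)%N; last by rewrite -ltnS.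
apply: ltn_sub2l => //.
have IG : mclosure M (e |: F :&: F') \subset G :&: F'.
  rewrite closure_min ?flatI // subUset sub1set in_setI {1}/G mem_closureU1 eF' subsetI subsetIr /= andbT.
  exact: subset_trans IH (sub_closureU1 _ _ _).
by have := rk_mono M IG; rewrite rk_closureU1.
Qed.

Lemma solves_ex n : exists xi, solves n xi.
Proof.
elim: n => [|n [xi [xi0 sol]]].
  by exists (fun=> 0); split=> // F K _ _ _ ->.
(* For [K] of rank one no such [F] exists; the default is harmless because no equation constrains
   the value there. *)
pose base K := odflt set0 [pick F | [&& flat F, F \subset K & (r F).+2 == r K]].
exists (fun K => if r K == n.+1 then next_value xi K (base K) else xi K).
split; first by rewrite rk_set0.
move=> F K fF fK FK rK; rewrite leq_eqVlt => /orP[/eqP rKn|]; last first.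
  rewrite ltnS => le; rewrite -sol // /defect.
  have lt : ((r F).+1 < n)%N by rewrite -rK.
  have neq m : (m <= n)%N -> m == n.+1 = false by move=> h; rewrite ltn_eqF.
  rewrite !neq //; last exact/ltnW/ltnW.
  congr (_ - _); apply: eq_bigr => p /atomsP[_ _ _ rp].
  by rewrite !neq ?rp // ltnW.
have rF : (r F).+1 = n by apply: succn_inj; rewrite -rK.
have sB : [/\ flat (base K), base K \subset K & (r (base K)).+1 = n].
  rewrite /base; case: pickP => [G /and3P[fG GK /eqP rG]|/(_ F)].
    by split=> //; apply: succn_inj; rewrite rG.
  by rewrite fF FK rK eqxx.
have [fB BK rB] := sB.
have nF m : (m <= n)%N -> (m == n.+1) = false by move=> le; rewrite ltn_eqF.
have rFn : (r F <= n)%N by rewrite -rF.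
rewrite /defect rKn eqxx (nF _ rFn) (next_value_const (conj xi0 sol) fK rKn fB fF BK FK rB rF).
rewrite /next_value.
have -> : \sum_(p in atoms M F K) ((if r p == n.+1 then next_value xi p (base p) else xi p) - xi F)
   = \sum_(p in atoms M F K) (xi p - xi F).
  by apply: eq_bigr => p /atomsP[_ _ _ rp]; rewrite nF // rp rF.
ring.
Qed.

(** Subtracting the modular function with all its mass [xi setT] at one element preserves the
    equations and clears the value at [setT]. *)
Lemma solves_top : exists xi, solves d.+1 xi /\ xi setT = 0.
Proof.
have [xi [xi0 sol]] := solves_ex d.+1.
have /set0Pn[e0 _] : [set: E] != set0 by apply/eqP => eT; move: rkT; rewrite eT rk_set0.
pose m e : A := if e == e0 then xi setT else 0.
exists (fun K => xi K - \sum_(e in K) m e); split; last first.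
  rewrite (bigD1 e0) ?inE //= big1 ?addr0 /m ?eqxx ?subrr // => e.
  by case/andP=> _ /negPf->.
split=> [|F K fF fK FK rK rKn]; first by rewrite xi0 big_set0 subrr.
rewrite -sol // /defect.
transitivity (\sum_(p in atoms M F K) ((xi p - xi F) - (\sum_(e in p) m e - \sum_(e in F) m e))
   - ((xi K - xi F) - (\sum_(e in K) m e - \sum_(e in F) m e))).
  by congr (_ - _); [apply: eq_bigr => p _|]; ring.
by rewrite sumrB sum_atoms_sub //; ring.
Qed.

(** If the gap had two inner ranks, the single flat completing the chain would need to have both. *)
Lemma corank1_gap T : chain T -> #|T|.+1 = d -> exists L U, adjacent T L U /\ r U = (r L).+2.
Proof.
move=> cT cardT; have [|G GT] := lk_ex loopM rkT cT; first by rewrite -cardT.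
have [L [U [adj LG GU]]] := lk_gap loopM rkT cT GT.
have [LT UT LU adjF] := adj; have fL := ext_flat loopM cT LT; have fU := ext_flat loopM cT UT.
have fG : flat G by case/lkP: GT => /pflat_flat.
have rLG := rk_proper fL LG; have rGU := rk_proper fG GU.
exists L, U; split=> //; apply/eqP; rewrite eqn_leq (leq_ltn_trans rLG rGU) andbT leqNgt.
apply/negP => lt3.
have cGT := chainU1 cT GT; have cardGT : #|G |: T| = d by rewrite (card_lkU1 GT).
have rUd : (r U <= d.+1)%N by rewrite -rkT rk_mono ?subsetT.
have rkG t : (r L < t < r U)%N -> r G = t.
  move=> /andP[Lt tU]; have [|K] := chain_hit loopM rkT (t := t) cGT cardGT.
  - by rewrite (leq_ltn_trans _ Lt) // -ltnS (leq_trans tU).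
  case/setU1P=> [->//|KT rK]; have /orP[KL|UK] := adjF K (in_extS KT).
    by have := rk_mono M KL; rewrite rK leqNgt Lt.
  by have := rk_mono M UK; rewrite rK leqNgt tU.
have := rkG (r L).+1; rewrite ltnSn (ltnW lt3) => /(_ isT) e1.
have := rkG (r L).+2; rewrite leqnSn lt3 e1 => /(_ isT) /eqP.
by rewrite ltn_eqF.
Qed.

(** The gap class of [T] is a defect of [xi]. Since [xi] vanishes at both ends, it expands over the
    indicator functions of proper flats; their excesses are the degrees, by [xs_corank1]. *)
Lemma duality_chain xi T : solves d.+1 xi -> xi setT = 0 -> chain T -> #|T|.+1 = d ->
  xs T = \sum_(K | pfl K) iota (D (xs T * x K)) * xi K.
Proof.
move=> [xi0 sol] xiT cT cardT; have [L [U [adj rU]]] := corank1_gap cT cardT.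
have [LT UT LU _] := adj; have fL := ext_flat loopM cT LT; have fU := ext_flat loopM cT UT.
have rUd : (r U <= d.+1)%N by rewrite -rkT rk_mono ?subsetT.
rewrite -[LHS](gap_classE cT cardT adj rU) -(sol L U fL fU (proper_sub LU) rU rUd) /defect.
have xiE F : flat F -> xi F = \sum_(K | pfl K) iota (restr (fun G => (G == K)%:R) F) * xi K.
  move=> fF; have [pF|npF] := boolP (pfl F).
    rewrite (bigD1 F) //= restrE // eqxx rmorph1 mul1r big1 ?addr0 // => K /andP[_ nK].
    by rewrite restrE // eq_sym (negPf nK) rmorph0 mul0r.
  rewrite big1 => [|K _]; last by rewrite /restr (negPf npF) rmorph0 mul0r.
  by move: npF; rewrite /is_pflat fF /= negb_and !negbK => /orP[]/eqP->.
transitivity (\sum_(K | pfl K) iota (excess (fun G => (G == K)%:R) L U) * xi K); last first.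
  apply: eq_bigr => K pK; congr (iota _ * _).
  by rewrite -(xs_corank1 _ cT cardT adj rU) lin_delta.
transitivity (\sum_(K | pfl K) (\sum_(p in atoms M L U)
    (iota (restr (fun G => (G == K)%:R) p) * xi K - iota (restr (fun G => (G == K)%:R) L) * xi K)
  - (iota (restr (fun G => (G == K)%:R) U) * xi K - iota (restr (fun G => (G == K)%:R) L) * xi K))).
  rewrite [RHS]sumrB [X in _ = X - _]exchange_big /=; congr (_ - _).
    by apply: eq_bigr => p /atomsP[fp _ _ _]; rewrite sumrB -!xiE.
  by rewrite sumrB -!xiE.
apply: eq_bigr => K _; rewrite /excess rmorphB mulrBl rmorph_sum mulr_suml rmorphB mulrBl.
by congr (_ - _); apply: eq_bigr => p _; rewrite rmorphB mulrBl.
Qed.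

(** * The span of chain monomials *)

(* Impredicative form of: [y] is a linear combination of monomials [xs T]. *)
Definition inspan k (y : A) := forall P : A -> Prop, P 0 ->
  (forall u v, P u -> P v -> P (u + v)) ->
  (forall (t : R) T, chain T -> #|T| = k -> P (iota t * xs T)) -> P y.

Lemma inspan0 k : inspan k 0. Proof. by move=> P. Qed.

Lemma inspanD k u v : inspan k u -> inspan k v -> inspan k (u + v).
Proof. by move=> hu hv P P0 PD Pc; apply: (PD); [exact: hu|exact: hv]. Qed.

Lemma inspan_chain k (t : R) T : chain T -> #|T| = k -> inspan k (iota t * xs T).
Proof. by move=> cT cardT P P0 PD Pc; apply: Pc. Qed.

Lemma inspanZ k (t : R) u : inspan k u -> inspan k (iota t * u).
Proof.
move=> hu; apply: (hu (fun u => inspan k (iota t * u))).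
- by rewrite mulr0; apply: inspan0.
- by move=> v w hv hw; rewrite mulrDr; apply: inspanD.
by move=> c' T cT cardT; rewrite mulrA -rmorphM; apply: inspan_chain.
Qed.

Lemma inspan_sum k (I : finType) (P : pred I) (f : I -> A) :
  (forall i, P i -> inspan k (f i)) -> inspan k (\sum_(i | P i) f i).
Proof.
by move=> h; apply: big_rec => [|i u Pi hu]; [apply: inspan0|apply: inspanD => //; apply: h].
Qed.

(** A representative of the divisor vanishing on [T] turns the monomial of [T] into monomials of
    larger chains, so products of divisors reduce to square-free monomials. *)
Lemma inspan_lin k c u : inspan k u -> inspan k.+1 (u * lin c).
Proof.
move=> hu; apply: (hu (fun u => inspan k.+1 (u * lin c))).
- by rewrite mul0r; apply: inspan0.
- by move=> v w hv hw; rewrite mulrDl; apply: inspanD.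
move=> c' T cT cardT; have [z [<- z0]] := lin_vanishing c cT.
rewrite -mulrA xs_lin //; apply: inspanZ; apply: inspan_sum => F FT.
by apply: inspan_chain; [apply: chainU1|rewrite (card_lkU1 FT) cardT].
Qed.

Lemma inspan_x k F u : pfl F -> inspan k u -> inspan k.+1 (u * x F).
Proof. by move=> pF hu; rewrite -(lin_delta pF); apply: inspan_lin. Qed.

Lemma inspan1 : inspan 0 1.
Proof.
rewrite -xs0 -[xs set0]mul1r -(rmorph1 iota).
by apply: inspan_chain; [exact: chain0|rewrite cards0].
Qed.

Lemma inspan_deg0 u : inspan 0 u -> exists t, u = iota t.
Proof.
move=> hu; apply: (hu (fun u => exists t, u = iota t)) => [|v w [s ->] [t ->]|t T _ /eqP].
  by exists 0; rewrite rmorph0.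
  by exists (s + t); rewrite rmorphD.
by rewrite cards_eq0 => /eqP->; exists t; rewrite xs0 mulr1.
Qed.

Lemma inspan_deg1 u : inspan 1 u -> exists c, u = lin c.
Proof.
move=> hu; apply: (hu (fun u => exists c, u = lin c)) => [|v w [b ->] [c ->]|t T cT /eqP/cards1P[F eT]].
- by exists (fun=> 0); rewrite /lin big1 // => F _; rewrite rmorph0 mul0r.
- by exists (fun F => b F + c F); rewrite linD.
have pF : pfl F by have [h _] := chainP _ _ cT; apply: h; rewrite eT inE.
by exists (fun G => t * (G == F)%:R); rewrite linZ lin_delta // eT /xs big_set1.
Qed.

Lemma inspan_exp k n c u : inspan k u -> inspan (k + n) (u * lin c ^+ n).
Proof.
move=> hu; elim: n => [|n IHn]; first by rewrite addn0 expr0 mulr1.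
by rewrite addnS exprSr mulrA; apply: inspan_lin.
Qed.

(** All full chains have the same class by [xs_top], so the top degree is spanned by one class of
    degree 1. *)
Lemma inspan_top u : inspan d u -> D u = 0 -> u = 0.
Proof.
have [T [cT _ cardT]] := chain_extend loopM rkT (chain0 M).
move=> hu Du; suff -> : u = iota (D u) * xs T by rewrite Du rmorph0 mul0r.
apply: (hu (fun u => u = iota (D u) * xs T)); first by rewrite D0 rmorph0 mul0r.
- by move=> v w {1}-> {1}->; rewrite DD rmorphD mulrDl.
move=> c T' cT' cardT'; rewrite DZ D_chain // mulr1.
by rewrite (xs_top cT cT').
Qed.

(** By linearity [duality_chain] recovers [u] from its pairings with the [x K]. *)
Lemma inspan_corank1 k u : k.+1 = d -> inspan k u ->
  (forall F, pfl F -> D (u * x F) = 0) -> u = 0.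
Proof.
move=> kd hu h; have [xi [sol xiT]] := solves_top.
suff -> : u = \sum_(K | pfl K) iota (D (u * x K)) * xi K.
  by apply: big1 => K pK; rewrite h // rmorph0 mul0r.
apply: (hu (fun u => u = \sum_(K | pfl K) iota (D (u * x K)) * xi K)).
- by symmetry; apply: big1 => K _; rewrite mul0r D0 rmorph0 mul0r.
- move=> v w ev ew; rewrite {1}ev {1}ew -big_split; apply: eq_bigr => K _ /=.
  by rewrite [in RHS]mulrDl DD rmorphD mulrDl.
move=> c T cT cardT; rewrite {1}(duality_chain sol xiT cT) ?cardT // mulr_sumr.
by apply: eq_bigr => K _; rewrite -mulrA DZ rmorphM mulrA.
Qed.

(** * Hard Lefschetz and Hodge-Riemann in degrees 0 and 1 *)

Lemma D_ample_pos : 0 < D (l ^+ d).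
Proof.
by have := @D_pos d set0 (chain0 M); rewrite xs0 mul1r; apply; rewrite cards0.
Qed.

Lemma lefschetz0 u : inspan d u -> exists k, iota k * l ^+ d = u.
Proof.
move=> hu; exists (D u / D (l ^+ d)); apply/eqP; rewrite -subr_eq0; apply/eqP.
apply: inspan_top; last by rewrite DD DN DZ divfK ?subrr // gt_eqF // D_ample_pos.
rewrite -mulN1r -(rmorph1 iota) -rmorphN; apply: inspanD; last exact: inspanZ.
by apply: inspanZ; rewrite -[l ^+ d]mul1r; apply: inspan_exp inspan1.
Qed.

Section Degree1.
Variable k : nat.
Hypothesis kd : k.+2 = d.

Lemma kernel_eq0 c : in_kernel set0 k c -> lin c = 0.
Proof.
move=> kc; apply: lin_eq0 => T cT cardT.
by apply: (kernel_chain cT (sub0set T) _ cardT kc); rewrite cards0.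
Qed.

Lemma lefschetz1_inj c : l ^+ k * lin c = 0 -> lin c = 0.
Proof.
move=> h; apply: kernel_eq0 => c'; rewrite xs0.
have -> : 1 * lin c * lin c' * l ^+ k = l ^+ k * lin c * lin c' by ring.
by rewrite h mul0r D0.
Qed.

(** Equality in the inequality of [hodge_all] would put [c] in the kernel by [hodge_null]. *)
Lemma hodge_riemann1 c : l ^+ k.+1 * lin c = 0 -> lin c != 0 ->
  D (lin c * lin c * l ^+ k) < 0.
Proof.
move=> h nz; have cardS : (#|@set0 {set E}|.+2 + k = d)%N by rewrite cards0.
have hS := hodge_all (chain0 M) cardS.
have ort : D (xs set0 * lin c * l ^+ k.+1) = 0 by rewrite xs0 mul1r mulrC h D0.
have := hS c ort; rewrite xs0 mul1r le_eqVlt => /orP[/eqP e|//].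
case/eqP: nz; apply: kernel_eq0; apply: hodge_null => //.
  by rewrite xs0 mul1r kd; apply: D_ample_pos.
by rewrite xs0 mul1r.
Qed.

(** Solving with the Gram matrix [Q] gives a class whose product with [l ^+ k] pairs with every
    [x F] as [u] does; this suffices by [inspan_corank1]. The system is solvable because a vector
    killed by [Q] represents the class zero. *)
Lemma lefschetz1_surj u : inspan k.+1 u -> exists c, l ^+ k * lin c = u.
Proof.
move=> hu; pose n := #|lk set0|.
have pE (i : 'I_n) : pfl (enum_val i) by have := enum_valP i; rewrite lk0.
pose Q : 'M[R]_n := \matrix_(i, j) D (x (enum_val i) * x (enum_val j) * l ^+ k).
pose b : 'rV[R]_n := \row_j D (u * x (enum_val j)).
pose vf (z : 'rV[R]_n) := vecfun (fun i => z 0 i).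
have vfE z v : D (lin (vf z) * v) = \sum_i z 0 i * D (x (enum_val i) * v).
  have := @D_xs_lin set0 (vf z) v (chain0 M); rewrite xs0 mul1r => ->; last by move=> F; rewrite inE.
  by rewrite sum_lk; apply: eq_bigr => i _; rewrite /vf vecfunE mul1r.
have [||z zQ] := @symmetric_solve R n Q b.
- by apply/matrixP => i j; rewrite !mxE [x _ * _]mulrC.
- move=> z zQ; have kz : in_kernel set0 k (vf z).
    move=> c'; rewrite xs0 mul1r -mulrA vfE.
    transitivity (\sum_j c' (enum_val j) * (z *m Q) 0 j).
      have ex v : D (lin c' * v) = \sum_(j < n) c' (enum_val j) * D (x (enum_val j) * v).
        have := @D_xs_lin set0 c' v (chain0 M); rewrite xs0 mul1r => ->; last by move=> F; rewrite inE.
        by rewrite sum_lk; apply: eq_bigr => i _; rewrite mul1r.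
      under eq_bigr => i _ do rewrite mulrCA ex mulr_sumr.
      rewrite exchange_big; apply: eq_bigr => j _; rewrite mxE mulr_sumr.
      by apply: eq_bigr => i _; rewrite mxE mulrCA; congr (_ * (_ * D _)); ring.
    by apply: big1 => j _; rewrite zQ mxE mulr0.
  apply/matrixP => i j; rewrite !ord1 !mxE.
  transitivity (D (lin (vf z) * u)); last by rewrite kernel_eq0 // mul0r D0.
  by rewrite vfE; apply: eq_bigr => m _; rewrite !mxE mulrC [u * _]mulrC.
exists (vf z); apply/eqP; rewrite -subr_eq0; apply/eqP.
apply: (@inspan_corank1 k.+1) => //.
  rewrite -mulN1r -(rmorph1 iota) -rmorphN; apply: inspanD; last exact: inspanZ.
  by apply: inspan_lin; rewrite -[l ^+ k]mul1r; apply: inspan_exp inspan1.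
move=> F pF; have [j ->] : exists j : 'I_n, F = enum_val j.
  by apply: enum_val_ex; rewrite lk0.
rewrite mulrBl DD DN; have /matrixP/(_ 0 j) := zQ; rewrite !mxE => <-.
apply/eqP; rewrite subr_eq0; apply/eqP.
have -> : l ^+ k * lin (vf z) * x (enum_val j) = lin (vf z) * (x (enum_val j) * l ^+ k) by ring.
by rewrite vfE; apply: eq_bigr => i _; rewrite mxE mulrA.
Qed.

End Degree1.
End Chow.

(** * The Chow ring as a quotient *)

Section Ideal.
Variables (E : finType) (M : matroid E) (R : realType).
Implicit Types (p q : polyM M R).
Local Notation inI := (@inI E M R).

Lemma inI0 : inI 0.
Proof.
exists (fun _ _ => 0), (fun _ _ => 0); rewrite !big1 ?addr0 // => i _; rewrite big1 // => j _.
  by rewrite mul0r.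
by rewrite mul0r.
Qed.

Lemma inID p q : inI p -> inI q -> inI (p + q).
Proof.
move=> [a [b ->]] [a' [b' ->]].
exists (fun F G => a F G + a' F G), (fun i j => b i j + b' i j).
rewrite addrACA -!big_split; congr (_ + _); apply: eq_bigr => i _ /=;
  by rewrite -big_split; apply: eq_bigr => j _ /=; rewrite mulrDl.
Qed.

Lemma inIM p q : inI q -> inI (p * q).
Proof.
move=> [a [b ->]]; exists (fun F G => p * a F G), (fun i j => p * b i j).
rewrite mulrDr !mulr_sumr; congr (_ + _); apply: eq_bigr => i _;
  by rewrite mulr_sumr; apply: eq_bigr => j _; rewrite mulrA.
Qed.

Lemma inI_sum (I : Type) (s : seq I) (P : pred I) (f : I -> polyM M R) :
  (forall i, P i -> inI (f i)) -> inI (\sum_(i <- s | P i) f i).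
Proof. by move=> h; elim/big_rec: _ => [|i u Pi hu]; [exact: inI0|apply: inID => //; apply: h]. Qed.

Lemma inI_incomparable (F G : pflat M) : incomparable (val F) (val G) ->
  inI (xF R F * xF R G).
Proof.
move=> FG; exists (fun H K => ((H == F) && (K == G))%:R), (fun _ _ => 0).
rewrite [X in _ + X]big1 ?addr0; last by move=> i _; rewrite big1 // => j _; rewrite mul0r.
rewrite (bigD1 F) //= [X in _ + X]big1 ?addr0; last first.
  by move=> H /negPf nHF; rewrite big1 // => K _; rewrite nHF mul0r.
rewrite (bigD1 G) //= !eqxx mul1r big1 ?addr0 // => K /andP[_ /negPf nKG].
by rewrite nKG andbF mul0r.
Qed.

Lemma inI_linrel i j : inI (linrel M R i j).
Proof.
exists (fun _ _ => 0), (fun u v => ((u == i) && (v == j))%:R).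
rewrite [X in X + _]big1 ?add0r; last by move=> F _; rewrite big1 // => G _; rewrite mul0r.
rewrite (bigD1 i) //= [X in _ + X]big1 ?addr0; last first.
  by move=> u /negPf nui; rewrite big1 // => v _; rewrite nui mul0r.
rewrite (bigD1 j) //= !eqxx mul1r big1 ?addr0 // => v /negPf nvj.
by rewrite nvj andbF mul0r.
Qed.

Lemma xF_homog (F : pflat M) : xF R F \is 1.-homog.
Proof. by rewrite /xF dhomogX /= mdeg1. Qed.

Lemma linrel_homog i j : linrel M R i j \is 1.-homog.
Proof. by rewrite /linrel rpredB // rpred_sum // => F _; apply: xF_homog. Qed.

Lemma pihomogM n (N : nzRingType) k e (p q : {mpoly N[n]}) : q \is e.-homog ->
  pihomog mdeg k (p * q) = if (e <= k)%N then pihomog mdeg (k - e) p * q else 0.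
Proof.
move=> hq; have [m pE] : exists m, p = \sum_(j < m) pihomog mdeg j p.
  by exists (mmeasure mdeg p); apply: pihomog_partitionE.
rewrite {1}pE.
rewrite mulr_suml raddf_sum /=.
have hom j : pihomog mdeg j p * q \is (j + e).-homog by apply: dhomogM => //; apply: pihomogP.
have eqj j : pihomog mdeg k (pihomog mdeg j p * q) =
    if (j + e == k)%N then pihomog mdeg j p * q else 0.
  case: eqVneq => [<-|ne]; first by rewrite pihomog_dE.
  by apply: pihomog_ne0 (hom j).
under eq_bigr => j _ do rewrite eqj.
case: ifP => [ek|/negbT nek]; last first.
  apply: big1 => j _; case: eqP => // jk; case/negP: nek; by rewrite -jk leq_addl.
rewrite [in RHS]pE raddf_sum mulr_suml /=.
apply: eq_bigr => j _; have [<-|ne] := eqVneq (j + e)%N k; first by rewrite addnK pihomog_id.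
rewrite (@pihomog_ne0 _ _ _ (j : nat)) ?mul0r ?pihomogP //.
by rewrite -(eqn_add2r e) subnK.
Qed.

(** The generators are homogeneous, so the ideal is; this lets the degree map be read off from
    components of degree [d]. *)
Lemma inI_pihomog k p : inI p -> inI (pihomog mdeg k p).
Proof.
move=> [a [b ->]]; rewrite raddfD /= !raddf_sum /=; apply: inID; apply: inI_sum => i _.
  rewrite raddf_sum /=; apply: inI_sum => j ij.
  rewrite (pihomogM _ _ (dhomogM (xF_homog i) (xF_homog j))).
  by case: ifP => _; [apply: inIM; apply: inI_incomparable|exact: inI0].
rewrite raddf_sum /=; apply: inI_sum => j ij; rewrite (pihomogM _ _ (linrel_homog i j)).
by case: ifP => _; [apply: inIM; apply: inI_linrel|exact: inI0].
Qed.

(** All generators vanish at the origin. Hence 1 is not in the ideal and the quotient is a nonzero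
    ring. *)
Lemma inI_meval p : inI p -> p.@[fun=> 0] = 0.
Proof.
have x0 F : (xF R F).@[fun=> 0] = 0 by rewrite /xF mevalXU.
move=> [a [b ->]]; rewrite rmorphD !rmorph_sum /= !big1 ?addr0 // => i _.
  rewrite rmorph_sum big1 // => j _; rewrite rmorphM /= rmorphB !rmorph_sum /=.
  by rewrite !big1 ?subr0 ?mulr0.
by rewrite rmorph_sum big1 // => j _; rewrite !rmorphM /= x0 mul0r mulr0.
Qed.

(** Membership is an existential proposition; the quotient construction takes a boolean predicate,
    obtained classically. *)
Definition chow_ideal : pred (polyM M R) := fun p => `[< inI p >].

Lemma chow_idealP p : reflect (inI p) (p \in chow_ideal).
Proof. exact: asboolP. Qed.

Lemma chow_ideal_closed : idealr_closed chow_ideal.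
Proof.
split=> [| |u p q].
- exact/chow_idealP/inI0.
- by apply/chow_idealP => /inI_meval/eqP; rewrite rmorph1 oner_eq0.
by move=> /chow_idealP hp /chow_idealP hq; apply/chow_idealP/inID => //; apply: inIM.
Qed.

End Ideal.

HB.instance Definition _ (E : finType) (M : matroid E) (R : realType) :=
  isIdealr.Build {mpoly R[nvar M]} (@chow_ideal E M R) (@chow_ideal_closed E M R).

Section ChowRing.
Variables (E : finType) (M : matroid E) (R : realType).
Implicit Types (p q : polyM M R) (F : {set E}).

Definition chow_idealr : idealr {mpoly R[nvar M]} := @chow_ideal E M R.
Definition chow_ring : comNzRingType := {ideal_quot chow_idealr}.
Definition proj : {rmorphism {mpoly R[nvar M]} -> chow_ring} :=
  \pi_({ideal_quot chow_idealr})%qT.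

Lemma proj_eq p q : chow_eq p q <-> proj p = proj q.
Proof.
rewrite /chow_eq; split=> [h|/eqP].
  by apply/eqP; rewrite -Quotient.idealrBE; apply/chow_idealP.
by rewrite -Quotient.idealrBE => /chow_idealP.
Qed.

Lemma proj_eq0 p : inI p <-> proj p = 0.
Proof. by have := proj_eq p 0; rewrite /chow_eq subr0 rmorph0. Qed.

Definition scal : {rmorphism R -> chow_ring} := proj \o @mpolyC (nvar M) R.

Lemma projZ (k : R) p : proj (k *: p) = scal k * proj p.
Proof. by rewrite -mul_mpolyC rmorphM. Qed.

(** The default 1 is the convention adopted at [set0] and [setT]. *)
Definition xcl F : chow_ring := if insub F is Some G then proj (xF R G) else 1.

Lemma xcl_val (F : pflat M) : xcl (val F) = proj (xF R F).
Proof. by rewrite /xcl valK. Qed.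

Lemma xcl_npflat F : ~~ is_pflat M F -> xcl F = 1.
Proof. by move=> npF; rewrite /xcl insubN. Qed.

Lemma sum_pflat (V : nmodType) (P : pred {set E}) (f : {set E} -> V) :
  \sum_(F | is_pflat M F && P F) f F = \sum_(F : pflat M | P (val F)) f (val F).
Proof.
rewrite (reindex_omap (val : pflat M -> _) insub) /=; last first.
  by move=> F /andP[pF _]; rewrite insubT.
by apply: eq_bigl => F; rewrite valK eqxx andbT (valP F).
Qed.

Lemma xcl_incomparable F G : is_pflat M F -> is_pflat M G -> incomparable F G ->
  xcl F * xcl G = 0.
Proof.
move=> pF pG FG; have := @inI_incomparable E M R (Sub F pF) (Sub G pG) FG.
by move/proj_eq0; rewrite rmorphM -!xcl_val.
Qed.

Lemma xcl_linear i j : \sum_(F | is_pflat M F && (i \in F)) xcl F =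
  \sum_(F | is_pflat M F && (j \in F)) xcl F.
Proof.
have /proj_eq0 := @inI_linrel E M R i j; rewrite rmorphB => /eqP.
rewrite subr_eq0 !rmorph_sum => /eqP h; rewrite !(sum_pflat (fun F : {set E} => _ \in F)).
transitivity (\sum_(F : pflat M | i \in val F) proj (xF R F)).
  by apply: eq_bigr => F _; rewrite xcl_val.
by rewrite h; apply: eq_bigr => F _; rewrite xcl_val.
Qed.

Variables (d : nat) (deg : polyM M R -> R).
Hypotheses (loopM : loopless M) (rkT : rk M setT = d.+1) (deg_map : is_degree_map d deg).

(** The component of degree [d] is taken first because [deg] is only assumed to vanish on the part
    of the ideal in degree [d]. *)
Definition degree (u : chow_ring) : R := deg (pihomog mdeg d (repr u)).

Lemma degD p q : deg (p + q) = deg p + deg q.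
Proof. by case: deg_map => h _ _; have := h 1 p q; rewrite scale1r mul1r. Qed.

Lemma degree_proj p : degree (proj p) = deg (pihomog mdeg d p).
Proof.
rewrite /degree; set q := repr (proj p).
have : chow_eq q p by apply/proj_eq; apply: reprK.
move=> /(inI_pihomog d); rewrite raddfB /= => h.
have h0 : deg (pihomog mdeg d q - pihomog mdeg d p) = 0.
  by case: deg_map => _ + _; apply=> //; rewrite rpredB // pihomogP.
by rewrite -[pihomog mdeg d q](subrK (pihomog mdeg d p)) degD h0 add0r.
Qed.

Lemma degree_homog p : p \is d.-homog -> degree (proj p) = deg p.
Proof. by move=> hp; rewrite degree_proj pihomog_dE. Qed.

Lemma degree_lin k u v : degree (scal k * u + v) = k * degree u + degree v.
Proof.
have eu : u = proj (repr u) by symmetry; apply: reprK.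
have ev : v = proj (repr v) by symmetry; apply: reprK.
rewrite eu ev -projZ -rmorphD !degree_proj raddfD /= linearZ.
by case: deg_map => h _ _; rewrite h.
Qed.

Lemma prod_homog (P : pred (pflat M)) : \prod_(F | P F) xF R F \is #|P|.-homog.
Proof.
rewrite -sum1_card; elim/big_rec2: _ => [|F k p _ hp]; first exact: dhomog1.
exact: dhomogM (xF_homog R F) hp.
Qed.

Lemma degree_chain (S : {set {set E}}) : chain M S -> #|S| = d -> degree (\prod_(F in S) xcl F) = 1.
Proof.
move=> cS cardS; have [pS cmpS] := chainP _ _ cS.
pose C : {set pflat M} := [set F | val F \in S].
have prodE : \prod_(F in S) xcl F = proj (\prod_(F in C) xF R F).
  rewrite rmorph_prod (reindex_omap (val : pflat M -> _) insub) /=; last first.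
    by move=> F /pS pF; rewrite insubT.
  apply: eq_big => [F|F _]; last exact: xcl_val.
  by rewrite valK eqxx andbT inE.
have cardC : #|C| = d.
  rewrite -cardS -(card_imset _ (@val_inj _ _ (pflat M : subType _))); congr #|pred_of_set _|.
  apply/setP => F; apply/imsetP/idP => [[G]|FS]; first by rewrite inE => GS ->.
  by exists (Sub F (pS F FS)); rewrite ?inE /= ?SubK.
have homC : \prod_(F in C) xF R F \is d.-homog by rewrite -cardC; exact: prod_homog.
rewrite prodE degree_homog //; case: deg_map => _ _; apply.
apply/andP; split.
  apply/forall_inP => F; rewrite inE => FS; apply/forall_inP => G; rewrite inE => GS.
  by rewrite cmpNinc negbK cmpS.
apply/forallP => G; apply/implyP => /forall_inP hG; rewrite inE; apply/negPn/negP => GS.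
(* Maximality: a further flat comparable to all of [S] would give a chain of [d + 1] flats. *)
have GlS : val G \in lk M S.
  apply/lkP; split=> //; first exact: valP.
  move=> F FS; have := hG (Sub F (pS F FS)); rewrite inE SubK => /(_ FS).
  by rewrite cmpNinc negbK.
have := card_chain loopM rkT (chainU1 cS GlS).
by rewrite (card_lkU1 GlS) cardS ltnn.
Qed.

End ChowRing.

(** * Homogeneous polynomials as combinations of chain monomials *)

Section Transfer.
Variables (E : finType) (M : matroid E) (R : realType).
Local Notation span := (inspan M (@scal E M R) (@xcl E M R)).
Local Notation lin := (lin M (@scal E M R) (@xcl E M R)).
Implicit Types (p : polyM M R).

Lemma proj_divisor (c : {set E} -> R) (c' : pflat M -> R) : (forall F, c (val F) = c' F) ->
  proj M R (divisor c') = lin c.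
Proof.
move=> h; rewrite /divisor rmorph_sum /lin.
rewrite [RHS](eq_bigl (fun F => is_pflat M F && predT F)); last by move=> F; rewrite andbT.
by rewrite sum_pflat; apply: eq_bigr => F _; rewrite projZ h xcl_val.
Qed.

Lemma span_monomial k (m : 'X_{1..nvar M}) : mdeg m = k -> span k (proj M R 'X_[m]).
Proof.
elim: k m => [|k IHk] m mk.
  by move/eqP: mk; rewrite mdeg_eq0 => /eqP->; rewrite mpolyX0 rmorph1; apply: inspan1.
have [i mi] : exists i, m i != 0%N.
  apply/existsP; rewrite -negb_forall; apply: contra_eqN mk => /forallP h.
  by rewrite mdegE big1 // => i _; apply/eqP.
have le : (U_(i) <= m)%MM by rewrite lep1mP.
rewrite -(submK le) mpolyXD rmorphM.
have -> : proj M R 'X_i = xcl M R (val (enum_val i : pflat M)).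
  by rewrite xcl_val /xF enum_valK.
apply: (inspan_x (@xcl_incomparable E M R) (@xcl_linear E M R)).
  exact: valP.
by apply: IHk; apply: succn_inj; rewrite -mk -[in RHS](submK le) mdegD mdeg1 addn1.
Qed.

Lemma span_homog k p : p \is k.-homog -> span k (proj M R p).
Proof.
move=> /dhomogP hp; rewrite [p]mpolyE rmorph_sum big_seq_cond.
elim/big_rec: _ => [|m u /andP[mp _] hu]; first exact: inspan0.
by apply: inspanD => //; rewrite projZ; apply: inspanZ; apply: span_monomial; apply: hp.
Qed.

End Transfer.

Theorem theorem6p7 (E : finType) (M : matroid E) (d : nat) (R : realType)
    (deg : polyM M R -> R) :
  loopless M -> rk M setT = d.+1 ->
  is_degree_map d deg ->
  forall l : polyM M R, in_KM l ->
  forall i : nat, (i <= 1)%N -> (i <= d./2)%N ->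
    HL_deg d i l /\ HR_deg d i deg l.
Proof.
move=> loopM rkT deg_map l [l_hom [b [[a [a0 aT ab a_lt a_sub]] lb]]].
pose D := degree d deg.
have inc := @xcl_incomparable E M R.
have xlin := @xcl_linear E M R.
have D_lin := degree_lin deg_map.
have D_chain := degree_chain loopM rkT deg_map.
have x0 : xcl M R set0 = 1 by apply: xcl_npflat; rewrite /is_pflat eqxx andbF.
have xT : xcl M R setT = 1 by apply: xcl_npflat; rewrite /is_pflat eqxx !andbF.
have el : proj M R l = lin M (scal M R) (xcl M R) a.
  by move/proj_eq: lb => ->; apply: proj_divisor.
have DZ' := DZ D_lin.
have lpos : 0 < D (proj M R l ^+ d).
  by rewrite el; apply: (D_ample_pos loopM rkT inc xlin D_lin D_chain a0 aT a_sub a_lt).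
have projC t : proj M R t%:MP = scal M R t by [].
have homC t : (t%:MP : polyM M R) \is 0.-homog.
  by rewrite -[t%:MP]mulr1 mul_mpolyC dhomogZ // dhomog1.
move=> [|[|//]] _ hd.
  (* Degree 0: the classes are scalars, and all claims rest on the positivity of the degree of
     [l ^+ d]. *)
  rewrite /HL_deg /HR_deg muln0 subn0 expr0.
  have const x : x \is 0.-homog -> exists t, proj M R x = scal M R t.
    by move/span_homog/inspan_deg0.
  split; first split.
  - move=> x /const[t xt] /proj_eq0; rewrite rmorphM rmorphXn /= xt mulrC => h.
    apply/proj_eq0; rewrite xt; have := DZ' t (proj M R l ^+ d).
    rewrite h (D0 D_lin) => /esym/eqP; rewrite mulf_eq0 (gt_eqF lpos) orbF => /eqP->.
    exact: rmorph0.
  - move=> y /span_homog/(lefschetz0 loopM rkT inc xlin D_lin D_chain x0 xT a0 aT a_sub a_lt) [t ht].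
    exists t%:MP => //; apply/proj_eq.
    by rewrite rmorphM rmorphXn /= projC el mulrC.
  move=> x x_hom _ nx; have [t xt] := const x x_hom; rewrite mul1r.
  have t0 : t != 0 by apply: contra_notN nx => /eqP t0; apply/proj_eq0; rewrite xt t0 rmorph0.
  rewrite -(degree_homog deg_map); last first.
    by have := dhomogM (dhomogM x_hom x_hom) (dhomogMn d l_hom); rewrite mul1n.
  rewrite !rmorphM rmorphXn /= xt -rmorphM DZ' pmulr_lgt0 //.
  by rewrite -expr2 exprn_even_gt0.
(* Degree 1: the bound [1 <= d./2] gives [d = k + 2], so the exponent [d - 2 * 1] is [k]. *)
have [k kd] : exists k, k.+2 = d by case: (d) hd => [|[|k]] // _; exists k.
have dk : (d - 2 * 1 = k)%N by rewrite -kd muln1 !subSS subn0.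
have lk_hom : l ^+ k \is k.-homog by have := dhomogMn k l_hom; rewrite mul1n.
rewrite /HL_deg /HR_deg dk addn1.
have linear x : x \is 1.-homog -> exists c, proj M R x = lin M (scal M R) (xcl M R) c.
  by move/span_homog/inspan_deg1.
split; first split.
- move=> x /linear[c xc] /proj_eq0; rewrite rmorphM rmorphXn /= xc el => h.
  apply/proj_eq0; rewrite xc.
  exact: (lefschetz1_inj loopM rkT inc xlin D_lin D_chain a0 aT a_sub a_lt kd h).
- move=> y; rewrite -kd subn1 /= => /span_homog.
  move/(lefschetz1_surj loopM rkT inc xlin D_lin D_chain x0 xT a0 aT a_sub a_lt kd) => [c hc].
  exists (divisor (fun F => c (val F))).
    by rewrite /divisor rpred_sum // => F _; rewrite dhomogZ // xF_homog.
  by apply/proj_eq; rewrite rmorphM rmorphXn /= (proj_divisor (c := c)) // el.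
move=> x x_hom /proj_eq0; have [c xc] := linear x x_hom.
rewrite rmorphM rmorphXn /= xc el => h nx.
have nz : lin M (scal M R) (xcl M R) c != 0.
  by apply: contra_notN nx => /eqP h0; apply/proj_eq0; rewrite xc.
rewrite expr1 mulN1r oppr_gt0 -(degree_homog deg_map); last first.
  by rewrite -kd; apply: dhomogM (dhomogM x_hom x_hom) lk_hom.
rewrite !rmorphM rmorphXn /= xc el.
exact: (hodge_riemann1 loopM rkT inc xlin D_lin D_chain a0 aT a_sub a_lt kd h nz).
Qed.
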